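(* Let $(M,\phi)$ be a regular connection over $K_\infty[[t]]$ of rank $r$ with exponents $\lambda_1,\dots,\lambda_r$. (1) There exists a (possibly non-unique) $\phi$-stable $\mathbf L^{+,\dagger}_{K,\infty}$-lattice $M^\dagger\subset M$. (2) If $\mathrm{type}(-\lambda_i)>0$ for all $i$, then for any $\phi$-stable $\mathbf L^{+,\dagger}_{K,\infty}$-lattice $M^\dagger$ of $M$, the natural map $\mathrm{R}\Gamma(\phi,M^\dagger)\to\mathrm{R}\Gamma(\phi,M)$ is a quasi-isomorphism. (3) If $\mathrm{type}(\lambda_i-\lambda_j)>0$ for all pairs $i,j$, then the $\phi$-stable $\mathbf L^{+,\dagger}_{K,\infty}$-lattice of $M$ is unique (as a subset of $M$).
   Context: Let $K$ be a complete discretely valued field of characteristic $0$ with perfect residue field of characteristic $p$, $\overline K$ an algebraic closure with $p$-adic valuation $v_p$, $K_m=K(\mu_{p^m})$, $K_\infty=\bigcup_m K_m$, $t$ a variable. Let $\mathbf L^{+,\dagger}_{K,\infty}=\bigcup_m\mathbf O^\dagger(K_m,t)\subset K_\infty[[t]]$, where $\mathbf O^\dagger(K_m,t)\subset K_m[[t]]$ is the ring of power series with positive radius of convergence. For $A\in\{\mathbf L^{+,\dagger}_{K,\infty},K_\infty[[t]]\}$, a regular connection over $A$ is a finite free $A$-module $M$ with a $K_\infty$-linear $\phi:M\to M$ satisfying $\phi(fx)=t\frac{df}{dt}x+f\phi(x)$; its exponents are the eigenvalues in $\overline K$ of the induced map on $M/tM$. $\mathrm{R}\Gamma(\phi,M)=[M\xrightarrow{\phi}M]$.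 A $\phi$-stable $\mathbf L^{+,\dagger}_{K,\infty}$-lattice of $M$ is a $\phi$-stable finite free $\mathbf L^{+,\dagger}_{K,\infty}$-submodule $M^\dagger\subset M$ such that $M^\dagger\otimes K_\infty[[t]]\to M$ is an isomorphism. For $\lambda\in\overline K$, $\mathrm{type}(\lambda)\in[0,1]$ is the radius of convergence (for $|\cdot|=p^{-v_p}$) of $\sum_{m\ge0,m\ne\lambda}z^m/(\lambda-m)$. *)

(* Defs.v *)
From HB Require Import structures.
From mathcomp Require Import all_boot all_order all_algebra.
From mathcomp Require Import all_classical all_reals all_analysis.

Set Implicit Arguments.
Unset Strict Implicit.
Unset Printing Implicit Defensive.

Import Order.TTheory GRing.Theory Num.Theory.
Import numFieldNormedType.Exports.

Local Open Scope classical_set_scope.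
Local Open Scope ring_scope.

Section Valuations.
Variables (R : realType) (F : fieldType).
Implicit Types (v : F -> \bar R).

Definition is_valuation v : Prop :=
  [/\ forall x, v x = +oo%E <-> x = 0,
      forall x, v x <> -oo%E,
      forall x y, v (x * y) = (v x + v y)%E
    & forall x y, (Order.min (v x) (v y) <= v (x + y)%R)%E].

(* The value group of a discrete valuation is normalised to be the integers. *)
Definition is_discrete v : Prop :=
  (exists u, v u = 1%E) /\
  (forall x, x != 0 -> exists n : int, v x = (n%:~R)%:E).

Definition is_complete v : Prop :=
  forall u : nat -> F,
    (forall B : R, exists N, forall m n, (N <= m)%N -> (N <= n)%N ->
       (B%:E <= v (u m - u n)%R)%E) ->
    exists l, forall B : R, exists N, forall n, (N <= n)%N ->
       (B%:E <= v (u n - l)%R)%E.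

(* The prime p vanishes in the residue field { v >= 0 } / { v > 0 }. *)
Definition residue_char v (p : nat) : Prop := prime p /\ (0 < v p%:R)%E.

(* The Frobenius of the residue field, of characteristic p, is onto. *)
Definition residue_perfect v (p : nat) : Prop :=
  forall x, (0 <= v x)%E ->
    exists y, (0 <= v y)%E /\ (0 < v (x - y ^+ p)%R)%E.

Definition vabs (p : nat) v (x : F) : R :=
  if x == 0 then 0 else (p%:R : R) `^ (- fine (v x)).

(* Radius of convergence of sum_n (a n) z^n: over a non-archimedean field the
   series converges exactly when its terms tend to 0. *)
Definition radius (p : nat) v (a : nat -> F) : \bar R :=
  ereal_sup [set r%:E | r in
    [set r : R | 0 <= r /\ (fun n => vabs p v (a n) * r ^+ n) @ \oo --> (0 : R)]].

Definition padic_type (p : nat) v (lambda : F) : \bar R :=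
  radius p v (fun m => if lambda == m%:R then 0 else (lambda - m%:R)^-1).

End Valuations.

Definition is_subfield (F : fieldType) (S : set F) : Prop :=
  [/\ S 1, forall x y, S x -> S y -> S (x - y)
         & forall x y, S x -> S y -> S (x / y)].

Section Cyclotomic.
Variables (p : nat) (K : fieldType) (Kbar : closedFieldType).
Variable iota : {rmorphism K -> Kbar}.

(* K_m = K(mu_{p^m}) inside Kbar *)
Definition Kcyc (m : nat) : set Kbar :=
  \bigcap_(S in [set S | [/\ is_subfield S, range iota `<=` S
                           & [set z | z ^+ (p ^ m) = 1] `<=` S]]) S.

Lemma Kcyc_subfield m : is_subfield (Kcyc m).
Proof.
split=> [S [[]]//|x y xK yK S SK|x y xK yK S SK]; case: (SK) => -[_ SB SV] _ _.
- by apply: SB; [exact: xK | exact: yK].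
- by apply: SV; [exact: xK | exact: yK].
Qed.

Lemma Kcyc_le m n : (m <= n)%N -> Kcyc m `<=` Kcyc n.
Proof.
move=> mn x xK S [Sf SK Smu]; apply: xK; split=> // z /= z1; apply: Smu => /=.
by rewrite -(subnKC mn) expnD exprM z1 expr1n.
Qed.

Definition Kinf_pred : {pred Kbar} := fun x => `[< exists m, Kcyc m x >].

Lemma Kinf_divring_closed : divring_closed Kinf_pred.
Proof.
have H (x y : Kbar) : x \in Kinf_pred -> y \in Kinf_pred ->
    exists m, Kcyc m x /\ Kcyc m y.
  move=> /asboolP[m xm] /asboolP[n yn]; exists (maxn m n).
  by split; [apply: Kcyc_le xm; rewrite leq_maxl|apply: Kcyc_le yn; rewrite leq_maxr].
split.
- by apply/asboolP; exists 0%N; have [] := Kcyc_subfield 0.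
- move=> x y xK yK; have [m [xm ym]] := H _ _ xK yK; apply/asboolP; exists m.
  by have [_ SB _] := Kcyc_subfield m; apply: SB.
- move=> x y xK yK; have [m [xm ym]] := H _ _ xK yK; apply/asboolP; exists m.
  by have [_ _ SV] := Kcyc_subfield m; apply: SV.
Qed.

HB.instance Definition _ :=
  GRing.isDivringClosed.Build Kbar Kinf_pred Kinf_divring_closed.

(* K_infty, the union of the K_m *)
Record Kinf := KInf { Kinf_val : Kbar; _ : Kinf_val \in Kinf_pred }.

HB.instance Definition _ := [isSub for Kinf_val].
HB.instance Definition _ := [Choice of Kinf by <:].
HB.instance Definition _ := [SubChoice_isSubIntegralDomain of Kinf by <:].
HB.instance Definition _ := [SubIntegralDomain_isSubField of Kinf by <:].

End Cyclotomic.

Arguments Kinf : clear implicits.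
Arguments Kinf p {K Kbar} iota.

Record powser (F : Type) := Powser { coefs : nat -> F }.
Coercion coefs : powser >-> Funclass.

HB.instance Definition _ (F : Type) := gen_eqMixin (powser F).
HB.instance Definition _ (F : Type) := gen_choiceMixin (powser F).

Section PowerSeries.
Variable F : fieldType.
Implicit Types f g h : powser F.

Lemma powserP f g : (forall n, f n = g n) <-> f = g.
Proof.
split=> [|->//]; case: f g => [f] [g] /= fg; congr Powser; exact/funext.
Qed.

Definition ps0 : powser F := Powser (fun=> 0).
Definition ps_opp f := Powser (fun n => - f n).
Definition ps_add f g := Powser (fun n => f n + g n).
Definition ps_const (c : F) := Powser (fun n => c *+ (n == 0%N)).
Definition ps_mul f g := Powser (fun n => \sum_(i < n.+1) f i * g (n - i)%N).

Let ps_addA : associative ps_add.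
Proof. by move=> f g h; apply/powserP => n /=; rewrite addrA. Qed.
Let ps_addC : commutative ps_add.
Proof. by move=> f g; apply/powserP => n /=; rewrite addrC. Qed.
Let ps_add0 : left_id ps0 ps_add.
Proof. by move=> f; apply/powserP => n /=; rewrite add0r. Qed.
Let ps_addN : left_inverse ps0 ps_opp ps_add.
Proof. by move=> f; apply/powserP => n /=; rewrite addNr. Qed.

HB.instance Definition _ :=
  GRing.isZmodule.Build (powser F) ps_addA ps_addC ps_add0 ps_addN.

Let trunc N f : {poly F} := \poly_(i < N) f i.

Let trunc_mul N f g n : (n < N)%N ->
  ps_mul f g n = (trunc N f * trunc N g)`_n.
Proof.
move=> nN; rewrite coefM /=; apply: eq_bigr => i _.
rewrite !coef_poly (leq_trans (ltn_ord i) nN).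
by rewrite (leq_ltn_trans (leq_subr i n) nN).
Qed.

Let ps_mulC : commutative ps_mul.
Proof.
by move=> f g; apply/powserP => n; rewrite !(trunc_mul _ _ (ltnSn n)) mulrC.
Qed.

Let ps_mulA : associative ps_mul.
Proof.
move=> f g h; apply/powserP => n.
have E (a b : {poly F}) N : (n < N)%N -> (forall i, (i < N)%N -> a`_i = b`_i) ->
    forall c, (a * c)`_n = (b * c)`_n.
  move=> nN ab c; rewrite !coefM; apply: eq_bigr => i _.
  by rewrite ab// (leq_trans (ltn_ord i)).
have T a b : forall i, (i < n.+1)%N ->
    (trunc n.+1 (ps_mul a b))`_i = (trunc n.+1 a * trunc n.+1 b)`_i.
  by move=> i iN; rewrite coef_poly iN (trunc_mul _ _ iN).
rewrite !(trunc_mul _ _ (ltnSn n)) mulrC (E _ _ _ (ltnSn n) (T g h)).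
by rewrite (E _ _ _ (ltnSn n) (T f g)) mulrC mulrA.
Qed.

Let ps_mul1 : left_id (ps_const 1) ps_mul.
Proof.
move=> f; apply/powserP => n /=; rewrite big_ord_recl /= mul1r subn0 big1 ?addr0//.
by move=> i _; rewrite /= mul0r.
Qed.

Let ps_mulDl : left_distributive ps_mul ps_add.
Proof.
move=> f g h; apply/powserP => n /=; rewrite -big_split /=.
by apply: eq_bigr => i _; rewrite mulrDl.
Qed.

Let ps_one_neq0 : ps_const 1 != 0.
Proof.
by apply/eqP => /powserP /(_ 0%N); rewrite /= => /eqP; rewrite oner_eq0.
Qed.

HB.instance Definition _ := GRing.Zmodule_isComNzRing.Build (powser F)
  ps_mulA ps_mulC ps_mul1 ps_mulDl ps_one_neq0.

Definition psX : powser F := Powser (fun n => (n == 1%N)%:R).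
Definition ps_deriv f : powser F := Powser (fun n => f n.+1 *+ n.+1).

End PowerSeries.

(* O^dagger(K_m, t) and L^{+,dagger}_{K,infty}, as subrings of K_infty[[t]] *)
Section Overconvergent.
Variables (R : realType) (p : nat) (K : fieldType) (Kbar : closedFieldType).
Variables (iota : {rmorphism K -> Kbar}) (vp : Kbar -> \bar R).

Definition Odag (m : nat) : set (powser (Kinf p iota)) :=
  [set f | (forall n, Kcyc p iota m (Kinf_val (f n))) /\
           (0 < radius p vp (fun n => Kinf_val (f n)))%E].

Definition Ldag : set (powser (Kinf p iota)) := \bigcup_m Odag m.

End Overconvergent.

Section Modules.
Variables (A : comNzRingType) (M : lmodType A).

Definition is_basis (r : nat) (e : 'I_r -> M) : Prop :=
  forall x, exists! c : 'rV[A]_r, x = \sum_(i < r) c 0 i *: e i.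

Variable L : set A. (* a subring of A *)
Variable D : set M.

Definition is_submodule : Prop :=
  [/\ D 0, forall x y, D x -> D y -> D (x + y)
         & forall a x, L a -> D x -> D (a *: x)].

Definition is_finite_free : Prop :=
  exists (s : nat) (e : 'I_s -> M), (forall i, D (e i)) /\
    forall x, D x -> exists! c : 'rV[A]_s,
      (forall i, L (c 0 i)) /\ x = \sum_(i < s) c 0 i *: e i.

(* Elements of the tensor product of D and A over L are represented by formal
   sums of pure tensors x (x) a, identified by tensor_eq, the additive
   congruence generated by the defining relations. *)
Inductive tensor_eq :
  seq ({x : M | D x} * A) -> seq ({x : M | D x} * A) -> Prop :=
| tensor_refl s : tensor_eq s s
| tensor_sym s1 s2 : tensor_eq s1 s2 -> tensor_eq s2 s1
| tensor_trans s1 s2 s3 : tensor_eq s1 s2 -> tensor_eq s2 s3 -> tensor_eq s1 s3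
| tensor_cat s1 s2 s1' s2' :
    tensor_eq s1 s1' -> tensor_eq s2 s2' -> tensor_eq (s1 ++ s2) (s1' ++ s2')
| tensor_catC s1 s2 : tensor_eq (s1 ++ s2) (s2 ++ s1)
| tensor_0 x : tensor_eq [:: (x, 0)] [::]
| tensor_addr x a b : tensor_eq [:: (x, a + b)] [:: (x, a); (x, b)]
| tensor_addl x y z a : sval z = sval x + sval y ->
    tensor_eq [:: (z, a)] [:: (x, a); (y, a)]
| tensor_scale x z l a : L l -> sval z = l *: sval x ->
    tensor_eq [:: (z, a)] [:: (x, l * a)].

(* the natural map from the tensor product to M *)
Definition tensor_map (s : seq ({x : M | D x} * A)) : M :=
  \sum_(q <- s) q.2 *: sval q.1.

Definition tensor_map_iso : Prop :=
  (forall x, exists s, tensor_map s = x) /\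
  (forall s1 s2 : seq ({x : M | D x} * A),
     tensor_map s1 = tensor_map s2 -> tensor_eq s1 s2).

End Modules.

Definition is_stable_lattice (A : comNzRingType) (M : lmodType A) (L : set A)
    (phi : M -> M) (D : set M) : Prop :=
  [/\ is_submodule L D, is_finite_free L D, tensor_map_iso L D
    & forall x, D x -> D (phi x)].

Section Connections.
Variables (F : fieldType) (M : lmodType (powser F)).
Implicit Types phi : M -> M.

Definition is_connection phi : Prop :=
  (forall (c : F) x y,
     phi (ps_const c *: x + y) = ps_const c *: phi x + phi y) /\
  (forall f x, phi (f *: x) = (psX F * ps_deriv f) *: x + f *: phi x).

Definition is_regular_connection (r : nat) phi : Prop :=
  (exists e : 'I_r -> M, is_basis e) /\ is_connection phi.

(* N is the matrix of the map induced by phi on M / tM, in the basis given by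
   the classes of the e i. *)
Definition residue_matrix (r : nat) phi (e : 'I_r -> M) (N : 'M[F]_r) : Prop :=
  forall j, exists y : M,
    phi (e j) = \sum_(i < r) ps_const (N i j) *: e i + psX F *: y.

(* The lambda i are the eigenvalues, listed with multiplicity, of the map
   induced by phi on M / tM. *)
Definition has_exponents (E : fieldType) (inj : F -> E) (r : nat) phi
    (lambda : 'I_r -> E) : Prop :=
  exists (e : 'I_r -> M) (N : 'M[F]_r),
    [/\ is_basis e, residue_matrix phi e N
      & char_poly (map_mx inj N) = \prod_(i < r) ('X - (lambda i)%:P)].

End Connections.

(* Cohomology of the complex D --phi--> D, for D a phi-stable subgroup of M;
   elements of H^1 are cosets of phi(D) in D. *)
Section Cohomology.
Variables (M : zmodType) (phi : M -> M).
Implicit Type D : set M.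

Definition H0 D : set M := [set x | D x /\ phi x = 0].

Definition H1 D : set (set M) :=
  [set [set y + phi x | x in D] | y in D].

(* The inclusion of D in M sends y + phi(D) to y + phi(M). *)
Definition H1_map (C : set M) : set M :=
  [set y + phi x | y in C & x in [set: M]].

Definition RGamma_quasi_iso D : Prop :=
  set_bij (H0 D) (H0 [set: M]) id /\
  set_bij (H1 D) (H1 [set: M]) H1_map.

End Cohomology.

(* Main.v *)
(* In a basis, a regular connection is [theta + P] with [theta = t d/dt], and a
   stable lattice is the overconvergent span of a basis in which [P] is
   overconvergent.  All three statements concern the equation
   [theta X + P X - X Q = Y] for matrices of power series: its coefficient of
   [t^k] reads [(k + P_0) X_k - X_k Q_0 = Z_k], with [Z_k] depending on the
   earlier [X_i], and this Sylvester operator is invertible for large [k], its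
   eigenvalues being [k + lambda_i - mu_j].

   Existence: a gauge transformation [1 + O(t^(k0+1))] replaces [P] by its
   truncation at a large order [k0], a polynomial, whose coefficients lie in a
   single [K_m]; the transformed basis spans a stable lattice.

   Convergence (Clark): if [P], [Q], [Y] are overconvergent and the types of
   [mu_j - lambda_i] are positive, so is [X].  Cayley-Hamilton for [Q_0] bounds
   the inverse Sylvester operator by [C * prod_ij |mu_j - lambda_i - k|^-1], and
   the product of these bounds over [k <= n] grows at most exponentially in [n]:
   among the values [v (z - k)] one is at most linear in [n] because the type
   of [z] is positive, and the others add up to at most the valuation of a
   factorial.  With [Q = 0] this compares the cohomologies; applied to the
   transition matrix of two lattices it shows that they coincide. *)

Require Import Defs.
From HB Require Import structures.
From mathcomp Require Import all_boot all_order all_algebra.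
From mathcomp Require Import all_classical all_reals all_analysis.
From mathcomp Require Import zify.

Set Implicit Arguments.
Unset Strict Implicit.
Unset Printing Implicit Defensive.

Import Order.TTheory GRing.Theory Num.Theory.
Import numFieldNormedType.Exports.
Local Open Scope classical_set_scope.
Local Open Scope ring_scope.

Lemma logn_fact_sum (p n : nat) :
  logn p n`! = (\sum_(k < n) logn p k.+1)%N.
Proof.
elim: n => [|n IHn]; first by rewrite big_ord0 logn1.
by rewrite big_ord_recr factS lognM ?fact_gt0// addnC IHn.
Qed.

Lemma logn_fact_le (p n : nat) : prime p -> (logn p n`! <= n)%N.
Proof.
move=> p_prime; rewrite logn_fact//.
suff sum_divn_le j : (\sum_(1 <= k < j.+1) n %/ p ^ k + n %/ p ^ j <= n)%N.
  by apply: leq_trans (sum_divn_le n); rewrite leq_addr.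
elim: j => [|j IHj]; first by rewrite big_geq// add0n divn1.
rewrite big_nat_recr//= -addnA; apply: leq_trans IHj.
rewrite leq_add2l expnSr divnMA addnn -muln2.
apply: leq_trans (leq_mul (leqnn _) (prime_gt1 p_prime)) _.
exact: leq_divM.
Qed.

Lemma sum_logn_dist_le (p m n : nat) : prime p -> (m <= n)%N ->
  (\sum_(k < n.+1) logn p `|k - m|%N <= n)%N.
Proof.
move=> p_prime mn.
rewrite -(big_mkord xpredT (fun k => logn p `|k - m|%N)).
rewrite (@big_cat_nat _ _ _ m)//=; last exact: leqW.
rewrite -[leqRHS](subnKC mn); apply: leq_add.
  apply: leq_trans (logn_fact_le m p_prime); rewrite logn_fact_sum.
  rewrite big_nat_rev big_mkord; apply: leq_sum => k _.
  by rewrite (_ : `| _ - m|%N = k.+1)//; have := ltn_ord k; lia.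
apply: leq_trans (logn_fact_le (n - m) p_prime); rewrite logn_fact_sum.
rewrite -{1}[m]add0n big_addn subSn// big_mkord big_ord_recl add0n distnn logn0.
by apply: leq_sum => k _; rewrite (_ : `| _ - m|%N = k.+1)// lift0; lia.
Qed.

Lemma near_forall_leq (P : nat -> set nat) (n : nat) :
  (forall k, \forall N \near \oo, P k N) ->
  \forall N \near \oo, forall k, (k <= n)%N -> P k N.
Proof.
move=> nearP; have : \forall N \near \oo, forall k : 'I_n.+1, P k N.
  by apply: filter_forall => k; exact: nearP.
by apply: filterS => N PN k; rewrite -ltnS => kn; exact: (PN (Ordinal kn)).
Qed.

Lemma near_mxOver (T : Type) (S : nat -> {pred T}) (m n : nat)
    (A : 'M[T]_(m, n)) :
  (forall i j, \forall N \near \oo, A i j \in S N) ->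
  \forall N \near \oo, A \is a mxOver (S N).
Proof.
move=> nearA; have : \forall N \near \oo, forall ij : 'I_m * 'I_n,
    A ij.1 ij.2 \in S N by apply: filter_forall => ij; exact: nearA.
by apply: filterS => N AN; apply/mxOverP => i j; exact: (AN (i, j)).
Qed.

(** * Valuations *)

Record valuation (R : realType) (F : fieldType) := Valuation {
  valuation_fun :> F -> \bar R;
  valuationP : is_valuation valuation_fun }.

Section Valuation.
Variables (R : realType) (F : fieldType) (v : valuation R F).
Implicit Types (x y : F) (c n : nat).

Lemma valuation0 : v 0 = +oo%E.
Proof. by case: (valuationP v) => v_oo _ _ _; apply/v_oo. Qed.

Lemma valuationM x y : v (x * y) = (v x + v y)%E.
Proof. by case: (valuationP v). Qed.

Lemma valuationD_ge_min x y : (Order.min (v x) (v y) <= v (x + y)%R)%E.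
Proof. by case: (valuationP v). Qed.

Lemma valuation_fin_num x : x != 0 -> v x \is a fin_num.
Proof.
case: (valuationP v) => v_oo v_Noo _ _ x0; rewrite fin_numE; apply/andP; split.
  exact/eqP/v_Noo.
by apply: contra_neq x0 => /v_oo.
Qed.

Lemma valuation1 : v 1 = 0%E.
Proof.
have := valuationM 1 1.
rewrite mulr1 -(fineK (valuation_fin_num (oner_neq0 F))) => -[] /eqP.
by rewrite -subr_eq0 opprD addrA subrr sub0r oppr_eq0 => /eqP ->.
Qed.

Lemma valuationV x : x != 0 -> v x^-1 = (- v x)%E.
Proof.
move=> x0; have xV0 : x^-1 != 0 by rewrite invr_eq0.
have := valuationM x x^-1; rewrite divff// valuation1.
rewrite -(fineK (valuation_fin_num x0)) -(fineK (valuation_fin_num xV0)).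
move=> [] /eqP; rewrite eq_sym addr_eq0 => /eqP ->.
by rewrite -EFinN opprK.
Qed.

Lemma valuationN1 : v (-1) = 0%E.
Proof.
have N1_neq0 : (-1 : F) != 0 by rewrite oppr_eq0 oner_neq0.
have := valuationM (-1) (-1).
rewrite mulrNN mulr1 valuation1 -(fineK (valuation_fin_num N1_neq0)).
by move=> [] /eqP; rewrite eq_sym -mulr2n mulrn_eq0 => /eqP ->.
Qed.

Lemma valuationN x : v (- x) = v x.
Proof. by rewrite -mulN1r valuationM valuationN1 add0e. Qed.

Lemma valuationX x n : v (x ^+ n) = (v x *+ n)%E.
Proof.
elim: n => [|n IHn]; first by rewrite expr0 valuation1.
by rewrite exprS valuationM IHn; case: n {IHn} => [|n]; rewrite ?adde0.
Qed.

(* The ball of radius [p ^ c] when [v p = 1] and [`|x| = p ^ (- v x)]. *)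
Definition vball c : {pred F} := fun x => ((- c%:R)%:E <= v x)%E.

Lemma vballE c x : (x \in vball c) = ((- c%:R)%:E <= v x)%E.
Proof. by []. Qed.

Fact vball_zmod_closed c : zmod_closed (vball c).
Proof.
split=> [|x y xc yc]; first by rewrite vballE valuation0 leey.
rewrite vballE; apply: le_trans (valuationD_ge_min _ _).
by rewrite le_min valuationN -!vballE xc.
Qed.

HB.instance Definition _ c :=
  GRing.isZmodClosed.Build F (vball c) (vball_zmod_closed c).

Lemma vballS b c : (b <= c)%N -> {subset vball b <= vball c}.
Proof. by move=> bc x; apply: le_trans; rewrite lee_fin lerN2 ler_nat. Qed.

Lemma vball_nat c n : n%:R \in vball c.
Proof. by rewrite rpredMn// vballE valuation1 lee_fin oppr_le0. Qed.

Lemma vballM b c x y :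
  x \in vball b -> y \in vball c -> x * y \in vball (b + c).
Proof. by move=> xb yc; rewrite vballE valuationM natrD opprD EFinD leeD. Qed.

Lemma vball_prod (I : Type) (r : seq I) (c : I -> nat) (E : I -> F) :
  (forall i, E i \in vball (c i)) ->
  \prod_(i <- r) E i \in vball (\sum_(i <- r) c i).
Proof.
move=> Ec; elim/big_rec2: _ => [|i x y _]; first exact: (vball_nat 0 1).
exact: vballM.
Qed.

Lemma vball_exists x : exists c, x \in vball c.
Proof.
have [->|x0] := eqVneq x 0; first by exists 0%N; exact: rpred0.
exists (Num.bound `|fine (v x)|).
rewrite vballE -(fineK (valuation_fin_num x0)) lee_fin lerNl.
apply: le_trans (ltW (archi_boundP (normr_ge0 _))).
by rewrite -normrN ler_norm.
Qed.

Definition pole_order x : nat := ex_minn (vball_exists x).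

Lemma vball_pole_order c x : (x \in vball c) = (pole_order x <= c)%N.
Proof.
rewrite /pole_order; case: ex_minnP => b xb b_min.
by apply/idP/idP => [/b_min//|bc]; apply: vballS xb.
Qed.

Lemma pole_order_inv_le c x : (v x <= c%:R%:E)%E -> (pole_order x^-1 <= c)%N.
Proof.
rewrite -vball_pole_order; have [->|x0 vx] := eqVneq x 0.
  by rewrite valuation0.
by rewrite vballE valuationV// EFinN leeN2.
Qed.

End Valuation.

Section ResidueCharacteristic.
Variables (R : realType) (F : fieldType) (v : valuation R F) (p : nat).
Hypotheses (p_prime : prime p) (vp1 : v p%:R = 1%E).

Lemma valuation_natr_ge0 n : (0 <= v n%:R)%E.
Proof. by have := vball_nat v 0 n; rewrite vballE oppr0. Qed.

Lemma valuation_natr_coprime n : (0 < n)%N -> coprime n p -> v n%:R = 0%E.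
Proof.
move=> n_gt0 cop_np; apply/eqP; rewrite eq_le valuation_natr_ge0 andbT leNgt.
apply/negP => vn_gt0; case: (egcdnP p n_gt0) => a b bezout _.
have val_mul_gt0 k l : (0 < v l%:R -> 0 < v (k * l)%:R)%E.
  move=> /lt_le_trans; apply.
  by rewrite natrM valuationM leeDr// valuation_natr_ge0.
have : (0 < Order.min (v (a * n)%:R) (v (- (b * p)%:R)%R))%E.
  by rewrite lt_min valuationN !val_mul_gt0// vp1.
move=> /lt_le_trans/(_ (valuationD_ge_min v _ _)).
by rewrite bezout (eqP cop_np) natrD addrAC subrr add0r valuation1 ltxx.
Qed.

Lemma valuation_natr n : (0 < n)%N -> v n%:R = (logn p n)%:R%:E.
Proof.
move=> n_gt0; have [m cop_pm nE] := pfactor_coprime p_prime n_gt0.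
have m_gt0 : (0 < m)%N by move: n_gt0; rewrite nE muln_gt0 => /andP[].
rewrite {1}nE natrM valuationM natrX valuationX vp1.
by rewrite valuation_natr_coprime 1?coprime_sym// add0e -EFin_natmul.
Qed.

Lemma natr_neq0 n : (0 < n)%N -> n%:R != 0 :> F.
Proof.
move=> n_gt0; apply: contra_eqN (valuation_natr n_gt0) => /eqP ->.
by rewrite valuation0.
Qed.

(* Away from an index [m] maximising [v (z - k)], the ultrametric inequality
   gives [v (z - k) <= v (k - m)], so the total is at most that of a factorial. *)
Lemma sum_pole_order_inv_subr_nat (z : F) (c n : nat) :
  (forall k, (k <= n)%N -> (z - k%:R)^-1 \in vball v c) ->
  (\sum_(k < n.+1) pole_order v (z - k%:R)^-1 <= c + n)%N.
Proof.
move=> zc.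
have [m _ m_max] := @arg_maxP _ _ _ ord0 xpredT
  (fun k : 'I_n.+1 => v (z - (k : nat)%:R)) isT.
have pole_m : (pole_order v (z - m%:R)^-1 <= c)%N.
  by rewrite -vball_pole_order zc// -ltnS.
have pole_neq (k : 'I_n.+1) : k != m ->
    (pole_order v (z - k%:R)^-1 <= logn p `|k - m|)%N.
  move=> km; have dist_gt0 : (0 < `|k - m|)%N by rewrite lt0n distn_eq0.
  apply: pole_order_inv_le; rewrite -valuation_natr//.
  have -> : v `|k - m|%:R = v ((z - m%:R) - (z - k%:R)).
    rewrite opprB [_ + (_ - z)]addrC subrKA; have [mk|/ltnW km'] := leqP m k.
      by rewrite distnEl// natrB.
    by rewrite distnEr// natrB// -valuationN opprB.
  apply: le_trans (valuationD_ge_min v _ _).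
  by rewrite valuationN le_min lexx andbT; exact: m_max.
rewrite (bigD1 m)//=; apply: leq_add => //.
apply: leq_trans (sum_logn_dist_le p_prime (ltn_ord m : (m <= n)%N)).
by rewrite [leqRHS](bigD1 m)//= distnn logn0; apply: leq_sum.
Qed.

End ResidueCharacteristic.

(** * Power series *)

Section GeometricGrowth.
Variables (R : realType) (F : fieldType) (v : valuation R F).

Lemma near_vball (x : F) : \forall c \near \oo, x \in vball v c.
Proof. by exists (pole_order v x) => // c; rewrite vball_pole_order. Qed.

Definition geometric_growth (a : nat -> F) : Prop :=
  \forall c \near \oo, forall n, a n \in vball v (c * n.+1).

Lemma geometric_growthP (a : nat -> F) :
  geometric_growth a <-> exists c, forall n, a n \in vball v (c * n.+1).
Proof.
split=> [[c _ ac]|[c ac]]; first by exists c; apply: ac => /=.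
by exists c => // d cd n; apply: vballS (ac n); rewrite leq_mul2r cd orbT.
Qed.

Variable p : nat.
Hypothesis p_gt1 : (1 < p)%N.

Let p_gt0 : 0 < p%:R :> R. Proof. by rewrite ltr0n ltnW. Qed.

Lemma vabs_ge0 (x : F) : 0 <= vabs p v x.
Proof. by rewrite /vabs; case: ifP => // _; rewrite powR_ge0. Qed.

Lemma vball_vabs c (x : F) : (x \in vball v c) = (vabs p v x <= p%:R ^+ c).
Proof.
rewrite vballE /vabs; have [->|x0] := eqVneq x 0.
  by rewrite valuation0 leey exprn_ge0// ltW.
have lnp_gt0 : 0 < ln (p%:R : R) by rewrite ln_gt0// ltr1n.
rewrite -{1}(fineK (valuation_fin_num v x0)) lee_fin lerNl.
rewrite -powR_mulrn ?(ltW p_gt0)//.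
by rewrite -[RHS]ler_ln ?posrE ?powR_gt0// !ln_powR ler_pM2r.
Qed.

Lemma geometric_growth_of_radius (a : nat -> F) :
  (0 < Defs.radius p v a)%E -> geometric_growth a.
Proof.
move=> /ereal_sup_gt[_ [r [r_ge0 ar_cvg0] <-]]; rewrite lte_fin => r_gt0.
have [N _ ar_le1] : \forall n \near \oo, vabs p v (a n) * r ^+ n < 1.
  move/cvgrPdist_lt: ar_cvg0 => /(_ 1 ltr01); apply: filterS => n.
  by rewrite sub0r normrN => /(le_lt_trans (ler_norm _)).
have [b rVb] : exists b : nat, r^-1 <= p%:R ^+ b.
  exists (Num.bound r^-1); apply: le_trans (ltW (archi_boundP _)) _.
    by rewrite invr_ge0.
  by rewrite -natrX ler_nat ltnW// ltn_expl.
near=> c => n; have [Nn|nN] := leqP N n.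
  apply: (@vballS _ _ _ (b * n)).
    by apply: leq_mul => //; near: c; exact: nbhs_infty_ge.
  rewrite vball_vabs exprM; have := ar_le1 n Nn.
  rewrite -ltr_pdivlMr ?exprn_gt0// mul1r -exprVn => /ltW/le_trans; apply.
  by rewrite lerXn2r// nnegrE ?invr_ge0// exprn_ge0// ltW.
apply: (@vballS _ _ _ c); first by rewrite leq_pmulr.
move: n {nN} (ltnW nN); near: c.
by apply: near_forall_leq => n; exact: near_vball.
Unshelve. all: by end_near. Qed.

Lemma radius_of_geometric_growth (a : nat -> F) :
  geometric_growth a -> (0 < Defs.radius p v a)%E.
Proof.
move=> /geometric_growthP[c ac]; pose r : R := p%:R ^- c.+1.
have r_gt0 : 0 < r by rewrite invr_gt0 exprn_gt0.
apply: lt_le_trans (_ : (r%:E <= _)%E); first by rewrite lte_fin.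
apply: ereal_sup_ubound; exists r => //; split; first exact: ltW.
have geom_cvg0 : geometric (p%:R ^+ c) p%:R^-1 @ \oo --> (0 : R).
  apply: cvg_geometric; rewrite ger0_norm ?invr_ge0 ?(ltW p_gt0)//.
  by rewrite invf_lt1// ltr1n.
apply: (@squeeze_cvgr _ _ _ _ (fun=> 0)) geom_cvg0; last exact: cvg_cst.
near=> n; rewrite mulr_ge0 ?vabs_ge0 ?exprn_ge0 ?(ltW r_gt0)//=.
apply: (@le_trans _ _ (p%:R ^+ (c * n.+1) * r ^+ n)).
  by apply: ler_wpM2r; [rewrite exprn_ge0// ltW|rewrite -vball_vabs].
rewrite mulnS exprD exprM -mulrA -exprMn /r exprS invfM mulrCA divff ?mulr1//.
by rewrite expf_neq0// gt_eqF.
Unshelve. all: by end_near. Qed.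

Lemma radius_gt0P (a : nat -> F) :
  (0 < Defs.radius p v a)%E <-> geometric_growth a.
Proof.
split; [exact: geometric_growth_of_radius | exact: radius_of_geometric_growth].
Qed.

End GeometricGrowth.

Section PowerSeries.
Variable F : fieldType.
Implicit Types f g : powser F.

Lemma powser_mulE f g k : (f * g) k = \sum_(i < k.+1) f i * g (k - i)%N.
Proof. by []. Qed.

Definition coefps k f : F := f k.

Fact coefps_zmod_morphism k : zmod_morphism (coefps k).
Proof. by []. Qed.

HB.instance Definition _ k :=
  GRing.isZmodMorphism.Build (powser F) F (coefps k) (coefps_zmod_morphism k).

Definition theta f : powser F := psX F * ps_deriv f.

Lemma coef_theta f k : theta f k = f k *+ k.
Proof.
rewrite powser_mulE; case: k => [|k].
  by rewrite big_ord1 /= mul0r mulr0n.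
rewrite !big_ord_recl /= mul0r add0r mul1r subn1 /=.
by rewrite big1 ?addr0// => i _; rewrite mul0r.
Qed.

Fact theta_zmod_morphism : zmod_morphism theta.
Proof.
by move=> f g; apply/powserP => k; rewrite coef_theta mulrnBl -!coef_theta.
Qed.

HB.instance Definition _ :=
  GRing.isZmodMorphism.Build (powser F) (powser F) theta theta_zmod_morphism.

Section Over.
Variable S : subringClosed F.

Definition powser_over : {pred powser F} := fun f => `[< forall k, f k \in S >].

Lemma powser_overP f : reflect (forall k, f k \in S) (f \in powser_over).
Proof. exact: asboolP. Qed.

Fact powser_over_subring_closed : subring_closed powser_over.
Proof.
split=> [|f g /powser_overP fS /powser_overP gS
         |f g /powser_overP fS /powser_overP gS].
- by apply/powser_overP => -[|k]; rewrite ?rpred0 ?rpred1.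
- by apply/powser_overP => k; rewrite rpredB.
- apply/powser_overP => k; rewrite powser_mulE rpred_sum// => i _.
  by rewrite rpredM.
Qed.

HB.instance Definition _ := GRing.isSubringClosed.Build (powser F) powser_over
  powser_over_subring_closed.

Lemma powser_over_theta f : f \in powser_over -> theta f \in powser_over.
Proof.
by move=> /powser_overP fS; apply/powser_overP => k; rewrite coef_theta rpredMn.
Qed.

End Over.
End PowerSeries.

Section MapPowser.
Variables (F E : fieldType) (j : {rmorphism F -> E}).

Definition map_powser (f : powser F) : powser E := Powser (fun k => j (f k)).

Lemma coef_map_powser f k : map_powser f k = j (f k).
Proof. by []. Qed.

Fact map_powser_zmod_morphism : zmod_morphism map_powser.
Proof. by move=> f g; apply/powserP => k; exact: rmorphB. Qed.

Fact map_powser_monoid_morphism : monoid_morphism map_powser.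
Proof.
split=> [|f g]; apply/powserP => k.
  by rewrite coef_map_powser rmorphMn rmorph1.
rewrite [RHS]powser_mulE /= rmorph_sum; apply: eq_bigr => i _; exact: rmorphM.
Qed.

HB.instance Definition _ := GRing.isZmodMorphism.Build (powser F) (powser E)
  map_powser map_powser_zmod_morphism.
HB.instance Definition _ := GRing.isMonoidMorphism.Build (powser F) (powser E)
  map_powser map_powser_monoid_morphism.

Lemma map_powser_theta f : map_powser (theta f) = theta (map_powser f).
Proof. by apply/powserP => k; rewrite coef_map_powser !coef_theta rmorphMn. Qed.

End MapPowser.

Section Convergent.
Variables (R : realType) (F : fieldType) (v : valuation R F).
Implicit Types f g : powser F.

Definition convergent : {pred powser F} := fun f => `[< geometric_growth v f >].

Lemma convergentP f : reflect (geometric_growth v f) (f \in convergent).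
Proof. exact: asboolP. Qed.

Fact convergent_subring_closed : subring_closed convergent.
Proof.
split=> [|f g /convergentP fc /convergentP gc
         |f g /convergentP fc /convergentP gc].
- by apply/convergentP/geometric_growthP; exists 0%N => n; exact: vball_nat.
- apply/convergentP; near=> c => n; rewrite rpredB//; move: n; near: c.
    exact: fc.
  exact: gc.
- move: fc gc => /geometric_growthP[b fb] /geometric_growthP[c gc].
  apply/convergentP/geometric_growthP; exists (b + c)%N => n.
  rewrite powser_mulE rpred_sum// => i _.
  apply: vballS (vballM (fb i) (gc (n - i)%N)).
  by rewrite mulnDl leq_add// leq_mul// ltnS ?leq_subr// -ltnS ltn_ord.
Unshelve. all: by end_near. Qed.

HB.instance Definition _ := GRing.isSubringClosed.Build (powser F) convergent
  convergent_subring_closed.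

Lemma convergent_theta f : f \in convergent -> theta f \in convergent.
Proof.
move=> /convergentP fc; apply/convergentP; near=> c => n.
by rewrite coef_theta rpredMn//; move: n; near: c; exact: fc.
Unshelve. all: by end_near. Qed.

End Convergent.

(** * The Sylvester operator *)

Section MatrixVball.
Variables (R : realType) (F : fieldType) (v : valuation R F).

Lemma near_mxOver_vball (m n : nat) (A : 'M[F]_(m, n)) :
  \forall c \near \oo, A \is a mxOver (vball v c).
Proof. by apply: near_mxOver => i j; exact: near_vball. Qed.

Lemma mxOver_vballS (b c m n : nat) (A : 'M[F]_(m, n)) : (b <= c)%N ->
  A \is a mxOver (vball v b) -> A \is a mxOver (vball v c).
Proof. by move=> /vballS/mxOverS; apply. Qed.

Lemma mxOver_vballM (b c m n q : nat) (A : 'M[F]_(m, n)) (B : 'M[F]_(n, q)) :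
  A \is a mxOver (vball v b) -> B \is a mxOver (vball v c) ->
  A *m B \is a mxOver (vball v (b + c)).
Proof.
move=> /mxOverP Ab /mxOverP Bc; apply/mxOverP => i j.
by rewrite mxE rpred_sum// => k _; exact: vballM.
Qed.

Lemma vball_signM c n (x : F) :
  ((-1) ^+ n * x \in vball v c) = (x \in vball v c).
Proof. by rewrite -signr_odd; case: odd; rewrite ?mulN1r ?rpredN ?mul1r. Qed.

Lemma vball_det (c n : nat) (A : 'M[F]_n) :
  A \is a mxOver (vball v c) -> \det A \in vball v (n * c).
Proof.
move=> /mxOverP Ac; rewrite rpred_sum// => s _; rewrite vball_signM.
rewrite -[X in (X * _)%N]card_ord -sum_nat_const.
by apply: vball_prod => i; exact: Ac.
Qed.

Lemma mxOver_vball_adj (c n : nat) (A : 'M[F]_n) :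
  A \is a mxOver (vball v c) -> \adj A \is a mxOver (vball v (n * c)).
Proof.
move=> /mxOverP Ac; apply/mxOverP => i j; rewrite mxE vball_signM.
apply: (@vballS _ _ _ (n.-1 * c)); first by rewrite leq_mul2r leq_pred orbT.
by apply/vball_det/mxOverP => k l; rewrite !mxE.
Qed.

Lemma mxOver_vball_cramer (c d m n : nat) (A : 'M[F]_m) (X : 'M[F]_(m, n)) :
  \det A != 0 -> A \is a mxOver (vball v c) ->
  A *m X \is a mxOver (vball v d) ->
  X \is a mxOver (vball v (pole_order v (\det A)^-1 + (m * c + d))).
Proof.
move=> detA Ac AXd.
have -> : X = (\det A)^-1 *: (\adj A *m (A *m X)).
  by rewrite mulmxA mul_adj_mx mul_scalar_mx scalerA mulVf// scale1r.
have /mxOverP adjAX := mxOver_vballM (mxOver_vball_adj Ac) AXd.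
by apply/mxOverP => i j; rewrite mxE vballM// vball_pole_order.
Qed.

End MatrixVball.

Lemma rpred_det (R : comNzRingType) (S : subringClosed R) n (A : 'M[R]_n) :
  A \is a mxOver S -> \det A \in S.
Proof.
move=> /mxOverP AS; rewrite rpred_sum// => s _.
by rewrite rpredMsign rpred_prod.
Qed.

Lemma mxOver_invmx (R : comUnitRingType) (S : divringClosed R) n (A : 'M[R]_n) :
  A \is a mxOver S -> invmx A \is a mxOver S.
Proof.
move=> AS; rewrite /invmx; case: ifP => // _; apply: mxOverZ.
  by rewrite rpredV rpred_det.
apply/mxOverP => i j; rewrite !mxE rpredMsign rpred_det//.
by apply/mxOverP => k l; rewrite !mxE (mxOverP AS).
Qed.

Lemma mxOver_mxvec (T : Type) (S : {pred T}) m n (X : 'M[T]_(m, n)) :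
  (mxvec X \is a mxOver S) = (X \is a mxOver S).
Proof.
apply/mxOverP/mxOverP => XS i j; first by rewrite -mxvecE XS.
by case/mxvec_indexP: j => k l; rewrite ord1 mxvecE XS.
Qed.

Section MatrixEndomorphism.
Variables (F : fieldType) (m n : nat).
Variable T : {linear 'M[F]_(m, n) -> 'M[F]_(m, n)}.
Hypothesis T_inj : forall X, T X = 0 -> X = 0.

Lemma lin_mx_unit : lin_mx T \in unitmx.
Proof.
rewrite -row_free_unit; apply: inj_row_free => u.
rewrite -{1}[u]vec_mxK mul_vec_lin => /eqP; rewrite mxvec_eq0 => /eqP/T_inj.
by move/(congr1 mxvec); rewrite vec_mxK linear0.
Qed.

Lemma mx_endo_surj Z : exists X, T X = Z.
Proof.
exists (vec_mx (mxvec Z *m invmx (lin_mx T))); apply: (can_inj mxvecK).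
by rewrite -mul_vec_lin vec_mxK mulmxKV// lin_mx_unit.
Qed.

Lemma mx_endo_preim_mxOver (S : divringClosed F) :
  (forall X, X \is a mxOver S -> T X \is a mxOver S) ->
  forall X, T X \is a mxOver S -> X \is a mxOver S.
Proof.
move=> TS X TXS.
have matTS : lin_mx T \is a mxOver S.
  apply/mxOverP => i j; rewrite !mxE /=.
  case/mxvec_indexP: i => i i'; case/mxvec_indexP: j => j j'.
  rewrite vec_mx_delta mxvecE; apply/mxOverP/TS/mxOverP => k l.
  by rewrite mxE rpred_nat.
rewrite -mxOver_mxvec -[mxvec X](mulmxK lin_mx_unit) mul_vec_lin.
by rewrite mxOverM ?mxOver_invmx// mxOver_mxvec.
Qed.

End MatrixEndomorphism.

Lemma horner_char_poly (R : comNzRingType) (n : nat) (A : 'M[R]_n) (x : R) :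
  (char_poly A).[x] = \det (x%:M - A).
Proof.
rewrite -horner_evalE -det_map_mx; congr (\det _).
apply/matrixP => i j; rewrite !mxE /= /horner_eval !hornerE.
by case: eqP => _; rewrite ?mulr1n ?mulr0n !hornerE.
Qed.

Lemma horner_char_polyD (R : comNzRingType) (n : nat) (A : 'M[R]_n) (c x : R) :
  (char_poly (c%:M + A)).[x] = (char_poly A).[x - c].
Proof. by rewrite !horner_char_poly raddfB /= opprD addrA. Qed.

Lemma char_poly_similar (R : comNzRingType) (m n : nat) (A : 'M[R]_m)
    (B : 'M[R]_n) (G : 'M[R]_(m, n)) (H : 'M[R]_(n, m)) :
  G *m H = 1%:M -> H *m G = 1%:M -> A *m G = G *m B ->
  char_poly A = char_poly B.
Proof.
move=> GH HG AG; have mn : m = n.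
  by apply/eqP; rewrite eqn_leq (mulmx1_min GH) (mulmx1_min HG).
case: n / mn in B G H GH HG AG *.
have -> : B = H *m A *m G by rewrite -mulmxA AG mulmxA HG mul1mx.
rewrite /char_poly; have -> : char_poly_mx (H *m A *m G) =
    map_mx polyC H *m char_poly_mx A *m map_mx polyC G.
  rewrite /char_poly_mx mulmxBr mulmxBl mul_mx_scalar -scalemxAl -!map_mxM HG.
  by rewrite map_mx1 scalemx1.
by rewrite !det_mulmx mulrAC -det_mulmx -map_mxM HG map_mx1 det1 mul1r.
Qed.

Lemma Cayley_Hamilton_prod (R : comNzRingType) (n : nat) (B : 'M[R]_n)
    (s : seq R) :
  char_poly B = \prod_(z <- s) ('X - z%:P) -> \prod_(z <- s) (B - z%:M) = 0.
Proof.
case: n B => [|n] B charB; first by apply/matrixP => -[].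
rewrite -(Cayley_Hamilton B) charB rmorph_prod /=.
by apply: eq_bigr => z _; rewrite rmorphB /= horner_mx_X horner_mx_C.
Qed.

Section Sylvester.
Variables (F : fieldType) (m n : nat).
Implicit Types (A : 'M[F]_m) (B : 'M[F]_n) (X : 'M[F]_(m, n)) (s : seq F).

Definition sylvester A B X : 'M[F]_(m, n) := A *m X - X *m B.

Fact sylvester_is_linear A B : linear (sylvester A B).
Proof.
move=> a X Y; rewrite /sylvester mulmxDr mulmxDl -scalemxAr -scalemxAl.
by rewrite scalerBr opprD addrACA.
Qed.

HB.instance Definition _ A B :=
  GRing.isLinear.Build F 'M[F]_(m, n) 'M[F]_(m, n) _ (sylvester A B)
    (sylvester_is_linear A B).

Lemma sylvester_mulr A B C X : comm_mx B C ->
  sylvester A B (X *m C) = sylvester A B X *m C.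
Proof. by move=> BC; rewrite /sylvester mulmxBl !mulmxA -!(mulmxA X) BC. Qed.

Lemma sylvester_shift A B X (z : F) :
  (z%:M - A) *m X = - (X *m (B - z%:M) + sylvester A B X).
Proof.
rewrite /sylvester mulmxBl mulmxBr mul_mx_scalar mul_scalar_mx.
by rewrite [in RHS]addrC subrKA opprB.
Qed.

Lemma comm_mxB_scalar B (z : F) : comm_mx B (B - z%:M).
Proof. by apply: comm_mxB; [exact: comm_mx_refl | exact: comm_mx_scalar]. Qed.

(* By [sylvester_shift], if [X *m (B - z)] and [sylvester A B X] vanish, so does
   [(z - A) *m X].  Since [X] is killed by the product of the [B - z] over all
   eigenvalues [z] of [B], these factors can be removed one by one; the same
   works for bounds instead of vanishing. *)
Lemma sylvester_inj A B X s :
  (forall z, z \in s -> (char_poly A).[z] != 0) ->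
  X *m \prod_(z <- s) (B - z%:M) = 0 -> sylvester A B X = 0 -> X = 0.
Proof.
elim: s X => [|z s IHs] X; first by rewrite big_nil mulmx1.
move=> charA; rewrite big_cons -mulmxE mulmxA => Xprod0 sylX0.
have Xz0 : X *m (B - z%:M) = 0.
  apply: IHs => // [w ws|]; first by apply: charA; rewrite inE ws orbT.
  by rewrite sylvester_mulr ?sylX0 ?mul0mx//; exact: comm_mxB_scalar.
have zAX0 : (z%:M - A) *m X = 0.
  by rewrite (sylvester_shift A B) Xz0 sylX0 addr0 oppr0.
apply/eqP; have := charA z (mem_head _ _); rewrite horner_char_poly => detA.
have /eqP := congr1 (mulmx (\adj (z%:M - A))) zAX0.
by rewrite mulmx0 mulmxA mul_adj_mx mul_scalar_mx scaler_eq0 (negbTE detA).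
Qed.

Lemma sylvester_vball (R : realType) (v : valuation R F) (b c d : nat) A B X s :
  (forall z, z \in s -> [/\ (char_poly A).[z] != 0,
     z%:M - A \is a mxOver (vball v b) & B - z%:M \is a mxOver (vball v c)]) ->
  X *m \prod_(z <- s) (B - z%:M) = 0 ->
  sylvester A B X \is a mxOver (vball v d) ->
  X \is a mxOver (vball v
    (d + \sum_(z <- s) (pole_order v (char_poly A).[z]^-1 + m * b + c))).
Proof.
elim: s X d => [|z s IHs] X d sAB.
  by rewrite big_nil mulmx1 => -> _; exact: rpred0.
have [detA Ab Bc] := sAB z (mem_head _ _).
rewrite !big_cons -mulmxE mulmxA => Xprod0 sylXd.
have := IHs (X *m (B - z%:M)) (d + c)%N _ Xprod0.
set sum := (\sum_(w <- s) _)%N => Xzd.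
apply: (@mxOver_vballS _ _ _ (pole_order v (char_poly A).[z]^-1 +
  (m * b + (d + c + sum)))); first lia.
rewrite horner_char_poly in detA *; apply: mxOver_vball_cramer => //.
rewrite (sylvester_shift A B) rpredN rpredD//.
  apply: Xzd => [w ws|]; first by apply: sAB; rewrite inE ws orbT.
  by rewrite sylvester_mulr ?mxOver_vballM//; exact: comm_mxB_scalar.
by apply: mxOver_vballS sylXd; lia.
Qed.

End Sylvester.

(** * The connection on homomorphisms *)

Lemma course_of_values_choice (T : Type) (x0 : T)
    (P : nat -> (nat -> T) -> T -> Prop) :
  (forall k f g x, (forall i, (i < k)%N -> f i = g i) -> P k f x -> P k g x) ->
  (forall k f, exists x, P k f x) ->
  exists f, forall k, P k f (f k).
Proof.
move=> P_local P_ex; pose prefix k f i := if (i < k)%N then f i else x0 : T.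
have /choice[next nextP] (kf : nat * (nat -> T)) := P_ex kf.1 kf.2.
pose g n := iter n (fun f k => next (k, prefix k f)) (fun=> x0).
have g_stable k : forall m n, (k < m)%N -> (k < n)%N -> g m k = g n k.
  elim/ltn_ind: k => k IHk [|m] [|n]//= km kn; congr (next (_, _)).
  by apply/funext => i; rewrite /prefix; case: ltnP => // ik; apply: IHk; lia.
exists (fun k => g k.+1 k) => k.
apply: P_local (nextP (k, prefix k (g k))) => i ik.
by rewrite /= /prefix ik; exact: (g_stable i k i.+1).
Qed.

Section CoefficientMatrices.
Variable F : fieldType.

Definition coefmx (k m n : nat) (X : 'M[powser F]_(m, n)) : 'M[F]_(m, n) :=
  map_mx (coefps k) X.

Fact coefmx_zmod_morphism k m n : zmod_morphism (@coefmx k m n).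
Proof. by move=> X Y; exact: map_mxB. Qed.

HB.instance Definition _ k m n :=
  GRing.isZmodMorphism.Build 'M[powser F]_(m, n) 'M[F]_(m, n) (@coefmx k m n)
    (@coefmx_zmod_morphism k m n).

Definition psmx (m n : nat) (X : nat -> 'M[F]_(m, n)) : 'M[powser F]_(m, n) :=
  \matrix_(i, j) Powser (fun k => X k i j).

Lemma coefmx_psmx k m n (X : nat -> 'M[F]_(m, n)) : coefmx k (psmx X) = X k.
Proof. by apply/matrixP => i j; rewrite !mxE. Qed.

Lemma coefmxP m n (X Y : 'M[powser F]_(m, n)) :
  (forall k, coefmx k X = coefmx k Y) <-> X = Y.
Proof.
split=> [XY|->//]; apply/matrixP => i j; apply/powserP => k.
by have /matrixP/(_ i j) := XY k; rewrite !mxE.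
Qed.

Lemma coefmx1 k n : coefmx k (1%:M : 'M[powser F]_n) = (k == 0%N)%:R%:M.
Proof. by apply/matrixP => i j; rewrite !mxE; case: (i == j). Qed.

Lemma coefmxM k m n q (X : 'M[powser F]_(m, n)) (Y : 'M[powser F]_(n, q)) :
  coefmx k (X *m Y) = \sum_(i < k.+1) coefmx i X *m coefmx (k - i) Y.
Proof.
apply/matrixP => a b; rewrite !mxE raddf_sum summxE.
under [RHS]eq_bigr do rewrite mxE.
rewrite exchange_big; apply: eq_bigr => j _.
by apply: eq_bigr => i _; rewrite !mxE.
Qed.

Lemma coefmxMr k m n q (X : 'M[powser F]_(m, n)) (Y : 'M[powser F]_(n, q)) :
  coefmx k (X *m Y) = \sum_(i < k.+1) coefmx (k - i) X *m coefmx i Y.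
Proof.
rewrite coefmxM (reindex_inj rev_ord_inj); apply: eq_bigr => i _.
by rewrite /= subSS subKn// -ltnS.
Qed.

Lemma coefmx_theta k m n (X : 'M[powser F]_(m, n)) :
  coefmx k (map_mx (@theta F) X) = k%:R *: coefmx k X.
Proof. by apply/matrixP => i j; rewrite !mxE /coefps coef_theta mulr_natl. Qed.

Lemma coefmx_over (S : subringClosed F) k m n (X : 'M[powser F]_(m, n)) :
  X \is a mxOver (powser_over S) -> coefmx k X \is a mxOver S.
Proof.
by move=> /mxOverP XS; apply/mxOverP => i j; rewrite mxE; exact/powser_overP.
Qed.

Lemma powser_mx_invertible n (G : 'M[powser F]_n) : coefmx 0 G = 1%:M ->
  exists H, G *m H = 1%:M /\ H *m G = 1%:M.
Proof.
move=> G0; pose tail k (h : nat -> 'M[F]_n) :=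
  \sum_(i < k) coefmx i.+1 G *m h (k - i.+1)%N.
have [||h hE] := @course_of_values_choice _ 0
  (fun k h x => x = (k == 0%N)%:R%:M - tail k h).
- move=> k f g x fg ->; congr (_ - _); apply: eq_bigr => i _.
  by rewrite fg//; have := ltn_ord i; lia.
- by move=> k f; eexists.
suff GH : G *m psmx h = 1%:M by exists (psmx h); split=> //; exact: mulmx1C.
apply/coefmxP => k; rewrite coefmx1 coefmxM big_ord_recl G0 mul1mx subn0.
rewrite coefmx_psmx hE -[RHS](subrK (tail k h)); congr (_ + _).
by apply: eq_bigr => i _; rewrite coefmx_psmx.
Qed.

Definition truncmx (k0 m n : nat) (X : 'M[powser F]_(m, n)) :
    'M[powser F]_(m, n) :=
  psmx (fun k => if (k <= k0)%N then coefmx k X else 0).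

Lemma coefmx_truncmx k k0 m n (X : 'M[powser F]_(m, n)) :
  coefmx k (truncmx k0 X) = if (k <= k0)%N then coefmx k X else 0.
Proof. exact: coefmx_psmx. Qed.

Lemma coefmx_subr_truncmx k k0 m n (X : 'M[powser F]_(m, n)) : (k <= k0)%N ->
  coefmx k (X - truncmx k0 X) = 0.
Proof. by move=> kk0; rewrite raddfB /= coefmx_truncmx kk0 subrr. Qed.

End CoefficientMatrices.

Section HomConnection.
Variables (F : fieldType) (m n : nat).
Implicit Types (P : 'M[powser F]_m) (Q : 'M[powser F]_n).
Implicit Types X Y : 'M[powser F]_(m, n).

(* The matrix of the connection induced on homomorphisms from a module with
   connection matrix [Q] to one with connection matrix [P]. *)
Definition hom_connection P Q X : 'M[powser F]_(m, n) :=
  map_mx (@theta F) X + P *m X - X *m Q.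

Fact hom_connection_zmod_morphism P Q : zmod_morphism (hom_connection P Q).
Proof.
move=> X Y; rewrite /hom_connection map_mxB mulmxBr mulmxBl addrACA -opprD.
by rewrite !opprB addrACA [RHS]addrACA; congr (_ + _); exact: addrC.
Qed.

HB.instance Definition _ P Q := GRing.isZmodMorphism.Build
  'M[powser F]_(m, n) 'M[powser F]_(m, n) (hom_connection P Q)
  (hom_connection_zmod_morphism P Q).

Definition indicial P Q k : 'M[F]_(m, n) -> 'M[F]_(m, n) :=
  sylvester (k%:R%:M + coefmx 0 P) (coefmx 0 Q).

HB.instance Definition _ P Q k := GRing.Linear.on (indicial P Q k).

Definition hom_connection_tail P Q k (x : nat -> 'M[F]_(m, n)) : 'M[F]_(m, n) :=
  \sum_(i < k)
    (coefmx i.+1 P *m x (k - i.+1)%N - x (k - i.+1)%N *m coefmx i.+1 Q).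

Lemma coefmx_hom_connection P Q X k :
  coefmx k (hom_connection P Q X) =
  indicial P Q k (coefmx k X) + hom_connection_tail P Q k (fun i => coefmx i X).
Proof.
rewrite raddfB raddfD /= coefmx_theta coefmxM coefmxMr !big_ord_recl /= subn0.
rewrite /indicial /sylvester mulmxDl mul_scalar_mx /hom_connection_tail sumrB.
rewrite opprD !addrA; congr (_ + _); rewrite -!addrA; congr (_ + (_ + _)).
exact: addrC.
Qed.

Lemma indicial_coefmx P Q X k :
  indicial P Q k (coefmx k X) = coefmx k (hom_connection P Q X) -
    hom_connection_tail P Q k (fun i => coefmx i X).
Proof. by rewrite coefmx_hom_connection addrK. Qed.

Lemma eq_hom_connection_tail P Q k x y : (forall i, (i < k)%N -> x i = y i) ->
  hom_connection_tail P Q k x = hom_connection_tail P Q k y.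
Proof.
by move=> xy; apply: eq_bigr => i _; rewrite xy//; have := ltn_ord i; lia.
Qed.

Lemma hom_connection_surj P Q Y k0 :
  (forall k, (k0 < k)%N -> forall Z, indicial P Q k Z = 0 -> Z = 0) ->
  (forall k, (k <= k0)%N -> coefmx k Y = 0) ->
  exists2 X, hom_connection P Q X = Y & forall k, (k <= k0)%N -> coefmx k X = 0.
Proof.
move=> indicial_inj Y0.
pose recursion k (x : nat -> 'M[F]_(m, n)) z := if (k <= k0)%N then z = 0
  else indicial P Q k z = coefmx k Y - hom_connection_tail P Q k x.
have [||x xE] := @course_of_values_choice _ 0 recursion.
- move=> k f g z fg; rewrite /recursion; case: leqP => // _ ->.
  by rewrite (eq_hom_connection_tail P Q fg).
- move=> k f; rewrite /recursion; case: leqP => [_|kk0]; first by exists 0.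
  by have [z zE] := mx_endo_surj (indicial_inj k kk0)
       (coefmx k Y - hom_connection_tail P Q k f); exists z.
have x0 k : (k <= k0)%N -> x k = 0.
  by move=> kk0; have := xE k; rewrite /recursion kk0.
exists (psmx x) => [|k kk0]; last by rewrite coefmx_psmx x0.
apply/coefmxP => k; rewrite coefmx_hom_connection coefmx_psmx.
have -> : (fun i => coefmx i (psmx x)) = x.
  by apply/funext => i; rewrite coefmx_psmx.
have := xE k; rewrite /recursion.
case: leqP => [kk0 ->|_ ->]; last by rewrite subrK.
rewrite Y0// raddf0 add0r /hom_connection_tail big1// => i _.
by rewrite x0 ?mulmx0 ?mul0mx ?subrr//; have := ltn_ord i; lia.
Qed.

Lemma hom_connection_over (S : divringClosed F) P Q X k0 :
  (forall k, (k0 < k)%N -> forall Z, indicial P Q k Z = 0 -> Z = 0) ->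
  P \is a mxOver (powser_over S) -> Q \is a mxOver (powser_over S) ->
  hom_connection P Q X \is a mxOver (powser_over S) ->
  (forall k, (k <= k0)%N -> coefmx k X \is a mxOver S) ->
  X \is a mxOver (powser_over S).
Proof.
move=> indicial_inj PS QS YS X0S.
suff XS k : coefmx k X \is a mxOver S.
  apply/mxOverP => i j; apply/powser_overP => k.
  by have /mxOverP/(_ i j) := XS k; rewrite mxE.
elim/ltn_ind: k => k IHk; have [kk0|kk0] := leqP k k0; first exact: X0S.
apply: (mx_endo_preim_mxOver (T := indicial P Q k)).
- exact: indicial_inj.
- move=> Z ZS; rewrite /= rpredB// mxOverM ?coefmx_over//.
  by rewrite rpredD ?coefmx_over// mxOver_scalar ?rpred0 ?rpred_nat.
rewrite /= indicial_coefmx rpredB ?coefmx_over// rpred_sum// => i _.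
have XkiS : coefmx (k - i.+1) X \is a mxOver S.
  by apply: IHk; have := ltn_ord i; lia.
by apply: rpredB; apply: mxOverM => //; exact: coefmx_over.
Qed.

End HomConnection.

Lemma map_hom_connection (F E : fieldType) (j : {rmorphism F -> E}) (m n : nat)
    (P : 'M[powser F]_m) (Q : 'M[powser F]_n) (X : 'M[powser F]_(m, n)) :
  map_mx (map_powser j) (hom_connection P Q X) =
  hom_connection (map_mx (map_powser j) P) (map_mx (map_powser j) Q)
    (map_mx (map_powser j) X).
Proof.
rewrite /hom_connection map_mxB map_mxD !map_mxM; congr (_ + _ - _).
by apply/matrixP => a b; rewrite !mxE; exact: map_powser_theta.
Qed.

Lemma coefmx_map_powser (F E : fieldType) (j : {rmorphism F -> E}) (k m n : nat)
    (X : 'M[powser F]_(m, n)) :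
  coefmx k (map_mx (map_powser j) X) = map_mx j (coefmx k X).
Proof. by apply/matrixP => a b; rewrite !mxE. Qed.

Lemma map_indicial (F E : fieldType) (j : {rmorphism F -> E}) (k m n : nat)
    (P : 'M[powser F]_m) (Q : 'M[powser F]_n) (X : 'M[F]_(m, n)) :
  map_mx j (indicial P Q k X) =
  indicial (map_mx (map_powser j) P) (map_mx (map_powser j) Q) k (map_mx j X).
Proof.
rewrite /indicial /sylvester map_mxB !map_mxM map_mxD map_scalar_mx rmorph_nat.
by rewrite !coefmx_map_powser.
Qed.

Lemma hom_connection1 (F : fieldType) (n : nat) (P Q : 'M[powser F]_n) :
  hom_connection P Q 1%:M = P - Q.
Proof.
rewrite /hom_connection mulmx1 mul1mx; apply/coefmxP => k.
rewrite !raddfD /= coefmx_theta coefmx1.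
case: k => [|k]; first by rewrite scale0r add0r.
by rewrite raddf0 scaler0 add0r.
Qed.

(** * Clark's convergence theorem *)

Section BoundedMean.
Implicit Type W : nat -> nat.

Definition bounded_mean W : Prop :=
  exists B, forall n, (\sum_(k < n.+1) W k <= B * n.+1)%N.

Lemma bounded_mean_const c : bounded_mean (fun=> c).
Proof. by exists c => n; rewrite sum_nat_const card_ord mulnC. Qed.

Lemma bounded_meanD W1 W2 :
  bounded_mean W1 -> bounded_mean W2 -> bounded_mean (fun k => W1 k + W2 k)%N.
Proof.
move=> [B1 W1B] [B2 W2B]; exists (B1 + B2)%N => n.
by rewrite big_split mulnDl leq_add.
Qed.

Lemma bounded_mean_sum (I : Type) (r : seq I) (W : I -> nat -> nat) :
  (forall i, bounded_mean (W i)) ->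
  bounded_mean (fun k => \sum_(i <- r) W i k)%N.
Proof.
move=> /choice[B WB]; exists (\sum_(i <- r) B i)%N => n.
by rewrite exchange_big big_distrl; apply: leq_sum => i _; exact: WB.
Qed.

End BoundedMean.

Section SmallDivisors.
Variables (R : realType) (E : fieldType) (v : valuation R E) (p : nat).
Hypotheses (p_prime : prime p) (vp1 : v p%:R = 1%E).

Lemma padic_type_gt0P (z : E) : (0 < padic_type p v z)%E <->
  geometric_growth v (fun k => (z - k%:R)^-1).
Proof.
rewrite -(radius_gt0P v (prime_gt1 p_prime)) /padic_type.
rewrite (_ : (fun k => _) = (fun k => (z - k%:R)^-1))//; apply/funext => k.
by case: eqP => // ->; rewrite subrr invr0.
Qed.

Lemma bounded_mean_pole_order (z : E) : (0 < padic_type p v z)%E ->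
  bounded_mean (fun k => pole_order v (z - k%:R)^-1).
Proof.
move=> /padic_type_gt0P/geometric_growthP[c zc]; exists c.+1 => n.
apply: (leq_trans (sum_pole_order_inv_subr_nat p_prime vp1 (c := c * n.+1) _)).
  by move=> k kn; apply: vballS (zc k); rewrite leq_mul2l ltnS kn orbT.
by rewrite mulSn addnC leq_add2r.
Qed.

Lemma near_subr_nat_neq0 (z : E) : \forall k \near \oo, z - k%:R != 0.
Proof.
have [[l zl]|z_nat] := pselect (exists l : nat, z = l%:R); last first.
  near=> k; apply/eqP => /eqP; rewrite subr_eq0 => /eqP zk.
  by apply: z_nat; exists k.
exists l.+1 => // k lk; rewrite zl -opprB oppr_eq0 -natrB ?(ltnW lk)//.
by rewrite (natr_neq0 p_prime vp1)// subn_gt0.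
Unshelve. all: by end_near. Qed.

End SmallDivisors.

Section Clark.
Variables (R : realType) (E : fieldType) (v : valuation R E) (p : nat).
Hypotheses (p_prime : prime p) (vp1 : v p%:R = 1%E).
Variables (m n : nat) (P : 'M[powser E]_m) (Q : 'M[powser E]_n).

Section Exponents.
Variables (I J : finType) (lambda : I -> E) (mu : J -> E).
Hypothesis char_P : char_poly (coefmx 0 P) = \prod_i ('X - (lambda i)%:P).
Hypothesis char_Q : char_poly (coefmx 0 Q) = \prod_j ('X - (mu j)%:P).

Lemma horner_char_poly_indicial (k : nat) (x : E) :
  (char_poly (k%:R%:M + coefmx 0 P)).[x] = \prod_i (x - lambda i - k%:R).
Proof.
rewrite horner_char_polyD char_P horner_prod; apply: eq_bigr => i _.
by rewrite hornerXsubC addrAC.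
Qed.

Lemma near_nonresonant : \forall k \near \oo, forall z, z \in codom mu ->
  (char_poly (k%:R%:M + coefmx 0 P)).[z] != 0.
Proof.
have : \forall k \near \oo, forall ij : I * J,
    mu ij.2 - lambda ij.1 - k%:R != 0.
  by apply: filter_forall => ij; exact: (near_subr_nat_neq0 p_prime vp1).
apply: filterS => k nonres _ /codomP[j ->].
rewrite horner_char_poly_indicial prodf_seq_neq0; apply/allP => i _.
exact: (nonres (i, j)).
Qed.

Lemma prod_codom_shift_eq0 : \prod_(z <- codom mu) (coefmx 0 Q - z%:M) = 0.
Proof.
by apply: Cayley_Hamilton_prod; rewrite char_Q big_map big_enum.
Qed.

Lemma near_indicial_inj :
  \forall k \near \oo, forall X, indicial P Q k X = 0 -> X = 0.
Proof.
apply: filterS near_nonresonant => k nonres X.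
by apply: (sylvester_inj nonres); rewrite prod_codom_shift_eq0 mulmx0.
Qed.

Hypothesis types_gt0 : forall i j, (0 < padic_type p v (mu j - lambda i)%R)%E.

Lemma near_mxOver_vball_shift (z : E) :
  \forall c \near \oo, forall k : nat,
    z%:M - (k%:R%:M + coefmx 0 P) \is a mxOver (vball v c).
Proof.
apply: filterS (near_mxOver_vball v (z%:M - coefmx 0 P)) => c zPc k.
rewrite opprD addrCA addrC rpredB// mxOver_scalar ?rpred0//.
exact: vball_nat.
Qed.

Lemma near_indicial_vball : exists2 W : nat -> nat, bounded_mean W &
  \forall k \near \oo, forall d X,
    indicial P Q k X \is a mxOver (vball v d) ->
    X \is a mxOver (vball v (d + W k)).
Proof.
have [c [Pc Qc]] : exists c, (forall j (k : nat),
      (mu j)%:M - (k%:R%:M + coefmx 0 P) \is a mxOver (vball v c)) /\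
    (forall j, coefmx 0 Q - (mu j)%:M \is a mxOver (vball v c)).
  near \oo => c; exists c; split=> j; move: j; near: c.
    by apply: filter_forall => j; exact: near_mxOver_vball_shift.
  by apply: filter_forall => j; exact: near_mxOver_vball.
exists (fun k => \sum_(j <- enum J)
  (\sum_i pole_order v (mu j - lambda i - k%:R)^-1 + (m * c + c)))%N.
  apply: bounded_mean_sum => j; apply: bounded_meanD.
    apply: bounded_mean_sum => i.
    exact: (bounded_mean_pole_order p_prime vp1).
  exact: bounded_mean_const.
apply: filterS near_nonresonant => k nonres d X Xd.
have Xprod0 : X *m \prod_(z <- codom mu) (coefmx 0 Q - z%:M) = 0.
  by rewrite prod_codom_shift_eq0 mulmx0.
apply: mxOver_vballS (sylvester_vball (b := c) (c := c) _ Xprod0 Xd).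
  rewrite leq_add2l big_map; apply: leq_sum => j _.
  rewrite -addnA leq_add2r -vball_pole_order horner_char_poly_indicial -prodfV.
  by apply: vball_prod => i; rewrite vball_pole_order.
by move=> z z_mu; split; [exact: nonres|..]; case/codomP: z_mu => j ->.
Unshelve. all: by end_near. Qed.

End Exponents.

Lemma hom_connection_vball (X : 'M[powser E]_(m, n)) (N k0 : nat)
    (W : nat -> nat) :
  (forall k, coefmx k P \is a mxOver (vball v (N * k.+1))) ->
  (forall k, coefmx k Q \is a mxOver (vball v (N * k.+1))) ->
  (forall k, coefmx k (hom_connection P Q X)
     \is a mxOver (vball v (N * k.+1))) ->
  (forall k, (k <= k0)%N -> coefmx k X \is a mxOver (vball v N)) ->
  (forall k, (k0 < k)%N -> forall d Z,
     indicial P Q k Z \is a mxOver (vball v d) ->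
     Z \is a mxOver (vball v (d + W k))) ->
  forall k, coefmx k X
    \is a mxOver (vball v (N * k.*2.+1 + \sum_(i < k.+1) W i)).
Proof.
move=> PN QN YN X0N indicialW; elim/ltn_ind=> k IHk.
have [kk0|kk0] := leqP k k0.
  by apply: mxOver_vballS (X0N k kk0); rewrite mulnS -addnA leq_addr.
rewrite big_ord_recr /= addnA; apply: indicialW => //.
rewrite indicial_coefmx; apply: rpredB.
  by apply: mxOver_vballS (YN k); nia.
apply: rpred_sum => i _; have ik := ltn_ord i.
have ki_lt : (k - i.+1 < k)%N by lia.
have sumW_le : (\sum_(l < (k - i.+1).+1) W l <= \sum_(l < k) W l)%N.
  rewrite -!(big_mkord xpredT W) [leqRHS](@big_cat_nat _ _ _ (k - i.+1).+1)//=.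
  exact: leq_addr.
(* [N * i.+2], from coefficient [i.+1] of [P] or [Q], is at most [2 * N * i.+1],
   the gain of going back [i.+1] steps. *)
have cost_le : (N * i.+2 + (N * (k - i.+1).*2.+1 + \sum_(l < (k - i.+1).+1) W l)
    <= N * k.*2.+1 + \sum_(l < k) W l)%N.
  by rewrite addnA leq_add// -mulnDr leq_mul//; lia.
apply: rpredB; apply: mxOver_vballS cost_le _.
  by apply: mxOver_vballM => //; exact: IHk.
by rewrite addnC; apply: mxOver_vballM => //; exact: IHk.
Qed.

Lemma near_coefmx_convergent (q r : nat) (X : 'M[powser E]_(q, r)) :
  X \is a mxOver (convergent v) ->
  \forall N \near \oo, forall k, coefmx k X \is a mxOver (vball v (N * k.+1)).
Proof.
move=> Xconv; have : \forall N \near \oo, forall (ij : 'I_q * 'I_r) k,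
    X ij.1 ij.2 k \in vball v (N * k.+1).
  by apply: filter_forall => ij; exact/convergentP/mxOverP.
apply: filterS => N XN k; apply/mxOverP => i j.
by rewrite mxE; exact: (XN (i, j)).
Qed.

Lemma hom_connection_convergent (I J : finType) (lambda : I -> E) (mu : J -> E)
    (X : 'M[powser E]_(m, n)) :
  char_poly (coefmx 0 P) = \prod_i ('X - (lambda i)%:P) ->
  char_poly (coefmx 0 Q) = \prod_j ('X - (mu j)%:P) ->
  (forall i j, (0 < padic_type p v (mu j - lambda i)%R)%E) ->
  P \is a mxOver (convergent v) -> Q \is a mxOver (convergent v) ->
  hom_connection P Q X \is a mxOver (convergent v) ->
  X \is a mxOver (convergent v).
Proof.
move=> char_P char_Q types_gt0 Pconv Qconv Yconv.
have [W [B sumW] [k0 _ indicialW]] :=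
  near_indicial_vball char_P char_Q types_gt0.
have [N [PN QN YN X0N]] : exists N,
    [/\ forall k, coefmx k P \is a mxOver (vball v (N * k.+1)),
        forall k, coefmx k Q \is a mxOver (vball v (N * k.+1)),
        forall k, coefmx k (hom_connection P Q X)
          \is a mxOver (vball v (N * k.+1))
      & forall k, (k <= k0)%N -> coefmx k X \is a mxOver (vball v N)].
  near \oo => N; exists N; split; near: N.
  - exact: near_coefmx_convergent.
  - exact: near_coefmx_convergent.
  - exact: near_coefmx_convergent.
  - by apply: near_forall_leq => k; exact: near_mxOver_vball.
have XNW k : coefmx k X \is a mxOver (vball v ((2 * N + B) * k.+1)).
  apply: mxOver_vballS (hom_connection_vball PN QN YN X0N _ k).
  - by rewrite mulnDl leq_add// (mulnC 2) -mulnA leq_mul//; lia.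
  - by move=> l /ltnW; exact: indicialW.
apply/mxOverP => i j; apply/convergentP/geometric_growthP.
by exists (2 * N + B)%N => k; have /mxOverP/(_ i j) := XNW k; rewrite mxE.
Unshelve. all: by end_near. Qed.

End Clark.

(** * Overconvergent series *)

Section Kinf.
Variables (p : nat) (K : fieldType) (Kbar : closedFieldType).
Variable iota : {rmorphism K -> Kbar}.

HB.instance Definition _ :=
  GRing.RMorphism.copy (@Kinf_val p K Kbar iota) (\val : Kinf p iota -> Kbar).

Definition Kcyc_pred (m : nat) : {pred Kinf p iota} :=
  fun x => `[< Kcyc p iota m (Kinf_val x) >].

Lemma Kcyc_predP m x : reflect (Kcyc p iota m (Kinf_val x)) (x \in Kcyc_pred m).
Proof. exact: asboolP. Qed.

Fact Kcyc_pred_divring_closed m : divring_closed (Kcyc_pred m).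
Proof.
have [K1 KB KV] := Kcyc_subfield p iota m.
split=> [|x y /Kcyc_predP xK /Kcyc_predP yK|x y /Kcyc_predP xK /Kcyc_predP yK].
- by apply/Kcyc_predP; rewrite rmorph1.
- by apply/Kcyc_predP; rewrite rmorphB; exact: KB.
- by apply/Kcyc_predP; rewrite fmorph_div; exact: KV.
Qed.

HB.instance Definition _ m := GRing.isDivringClosed.Build (Kinf p iota)
  (Kcyc_pred m) (Kcyc_pred_divring_closed m).

Lemma Kcyc_predS m n : (m <= n)%N -> {subset Kcyc_pred m <= Kcyc_pred n}.
Proof. by move=> mn x /Kcyc_predP xm; apply/Kcyc_predP; exact: Kcyc_le xm. Qed.

Lemma near_Kcyc_pred x : \forall m \near \oo, x \in Kcyc_pred m.
Proof.
have [m xm] : exists m, Kcyc p iota m (Kinf_val x) by case: x => x /= /asboolP.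
by exists m => // n mn; apply: Kcyc_predS mn _ _; apply/Kcyc_predP.
Qed.

End Kinf.

Arguments Kcyc_pred {p K Kbar} iota m.

Section Overconvergent.
Variables (R : realType) (p : nat) (K : fieldType) (Kbar : closedFieldType).
Variables (iota : {rmorphism K -> Kbar}) (v : valuation R Kbar).

Local Notation F := (Kinf p iota).
Local Notation inj := (@Kinf_val p K Kbar iota).
Implicit Types f g : powser F.

Definition overconvergent : {pred powser F} := fun f =>
  `[< (\forall N \near \oo, f \in powser_over (Kcyc_pred iota N)) /\
      map_powser inj f \in convergent v >].

Lemma overconvergentP f : reflect
  ((\forall N \near \oo, f \in powser_over (Kcyc_pred iota N)) /\
   map_powser inj f \in convergent v) (f \in overconvergent).
Proof. exact: asboolP. Qed.

Lemma LdagE : prime p -> Ldag v = [set` overconvergent].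
Proof.
move=> /prime_gt1 p_gt1; apply/funext => f; apply/propext.
split=> [[m _ [fm /(radius_gt0P v p_gt1) f_growth]]|/overconvergentP[[m _ fm]]].
  apply/overconvergentP; split; last exact/convergentP.
  exists m => // n mn; apply/powser_overP => k; apply: Kcyc_predS mn _ _.
  by apply/Kcyc_predP; exact: fm.
move=> /convergentP f_growth; exists m => //; split; last exact/radius_gt0P.
by have /powser_overP fK := fm m (leqnn m) => k; apply/Kcyc_predP/fK.
Qed.

Fact overconvergent_subring_closed : subring_closed overconvergent.
Proof.
split=> [|f g /overconvergentP[fK fc] /overconvergentP[gK gc]
         |f g /overconvergentP[fK fc] /overconvergentP[gK gc]].
- apply/overconvergentP; split; last by rewrite rmorph1 rpred1.
  by apply: nearW => N; rewrite rpred1.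
- apply/overconvergentP; split; last by rewrite rmorphB rpredB.
  by near=> N; rewrite rpredB//; near: N.
- apply/overconvergentP; split; last by rewrite rmorphM rpredM.
  by near=> N; rewrite rpredM//; near: N.
Unshelve. all: by end_near. Qed.

HB.instance Definition _ := GRing.isSubringClosed.Build (powser F)
  overconvergent overconvergent_subring_closed.

Lemma overconvergent_theta f :
  f \in overconvergent -> theta f \in overconvergent.
Proof.
move=> /overconvergentP[fK fc]; apply/overconvergentP; split.
  by near=> N; apply: powser_over_theta; near: N.
by rewrite map_powser_theta convergent_theta.
Unshelve. all: by end_near. Qed.

Lemma overconvergent_poly f k0 :
  (forall k, (k0 < k)%N -> f k = 0) -> f \in overconvergent.
Proof.
move=> f0; apply/overconvergentP; split.
  have := near_forall_leq k0 (fun k => near_Kcyc_pred (f k)).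
  apply: filterS => N fN; apply/powser_overP => k.
  by case: (leqP k k0) => [/fN//|/f0 ->]; exact: rpred0.
apply/convergentP.
have := near_forall_leq k0 (fun k => near_vball v (inj (f k))).
apply: filterS => c fc k; rewrite coef_map_powser.
case: (leqP k k0) => [/fc|/f0 ->]; last by rewrite rmorph0 rpred0.
by apply: vballS; rewrite leq_pmulr.
Qed.

Lemma truncmx_overconvergent k0 m n (X : 'M[powser F]_(m, n)) :
  truncmx k0 X \is a mxOver overconvergent.
Proof.
apply/mxOverP => i j; apply: (@overconvergent_poly _ k0) => k kk0.
by rewrite mxE /= leqNgt kk0 mxE.
Qed.

Lemma near_mxOver_overconvergent m n (X : 'M[powser F]_(m, n)) :
  X \is a mxOver overconvergent ->
  \forall N \near \oo, X \is a mxOver (powser_over (Kcyc_pred iota N)).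
Proof.
move=> /mxOverP Xov; apply: near_mxOver => i j.
by have /overconvergentP[] := Xov i j.
Qed.

Lemma map_mx_convergent m n (X : 'M[powser F]_(m, n)) :
  X \is a mxOver overconvergent ->
  map_mx (map_powser inj) X \is a mxOver (convergent v).
Proof.
move=> /mxOverP Xov; apply/mxOverP => i j; rewrite mxE.
by have /overconvergentP[] := Xov i j.
Qed.

Section HomConnection.
Hypotheses (p_prime : prime p) (vp1 : v p%:R = 1%E).
Variables (m n : nat) (P : 'M[powser F]_m) (Q : 'M[powser F]_n).
Variables (I J : finType) (lambda : I -> Kbar) (mu : J -> Kbar).
Hypothesis char_P :
  char_poly (map_mx inj (coefmx 0 P)) = \prod_i ('X - (lambda i)%:P).
Hypothesis char_Q :
  char_poly (map_mx inj (coefmx 0 Q)) = \prod_j ('X - (mu j)%:P).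

Lemma near_indicial_inj_Kinf :
  \forall k \near \oo, forall X, indicial P Q k X = 0 -> X = 0.
Proof.
move: char_P char_Q; rewrite -!coefmx_map_powser => char_mapP char_mapQ.
apply: filterS (near_indicial_inj p_prime vp1 char_mapP char_mapQ).
move=> k inj_k X X0.
apply: (@map_mx_inj _ _ inj); rewrite map_mx0; apply: inj_k.
by rewrite -map_indicial X0 map_mx0.
Qed.

Lemma hom_connection_overconvergent X :
  (forall i j, (0 < padic_type p v (mu j - lambda i)%R)%E) ->
  P \is a mxOver overconvergent -> Q \is a mxOver overconvergent ->
  hom_connection P Q X \is a mxOver overconvergent ->
  X \is a mxOver overconvergent.
Proof.
move=> types_gt0 Pov Qov Yov.
have [k0 _ indicial_inj] := near_indicial_inj_Kinf.
have XK : \forall N \near \oo, X \is a mxOver (powser_over (Kcyc_pred iota N)).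
  near=> N; apply: (@hom_connection_over _ _ _ _ P Q X k0).
  - by move=> k /ltnW; exact: indicial_inj.
  - by near: N; exact: near_mxOver_overconvergent.
  - by near: N; exact: near_mxOver_overconvergent.
  - by near: N; exact: near_mxOver_overconvergent.
  - near: N; apply: near_forall_leq => k.
    by apply: near_mxOver => i j; exact: near_Kcyc_pred.
have Xconv : map_mx (map_powser inj) X \is a mxOver (convergent v).
  move: char_P char_Q; rewrite -!coefmx_map_powser => char_mapP char_mapQ.
  apply: (hom_connection_convergent p_prime vp1 char_mapP char_mapQ) => //.
  - exact: map_mx_convergent.
  - exact: map_mx_convergent.
  - by rewrite -map_hom_connection map_mx_convergent.
apply/mxOverP => i j; apply/overconvergentP; split.
  by apply: filterS XK => N /mxOverP.
by have /mxOverP/(_ i j) := Xconv; rewrite mxE.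
Unshelve. all: by end_near. Qed.

End HomConnection.
End Overconvergent.

Arguments overconvergent {R p K Kbar} iota v _.

(** * Lattices *)

Section LinearCombinations.
Variables (A : comNzRingType) (M : lmodType A).

Definition lincomb (r s : nat) (e : 'I_r -> M) (X : 'M[A]_(r, s)) : 'I_s -> M :=
  fun j => \sum_(i < r) X i j *: e i.

Lemma lincombM r s q (e : 'I_r -> M) (X : 'M[A]_(r, s)) (Y : 'M[A]_(s, q)) :
  lincomb (lincomb e X) Y = lincomb e (X *m Y).
Proof.
apply/funext => j; rewrite /lincomb; under eq_bigr do rewrite scaler_sumr.
rewrite exchange_big; apply: eq_bigr => i _; rewrite mxE scaler_suml.
by apply: eq_bigr => k _; rewrite scalerA mulrC.
Qed.

Lemma lincombD r s (e : 'I_r -> M) (X Y : 'M[A]_(r, s)) j :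
  lincomb e (X + Y) j = lincomb e X j + lincomb e Y j.
Proof. by rewrite -big_split; apply: eq_bigr => i _; rewrite mxE scalerDl. Qed.

Lemma lincombZ r s (e : 'I_r -> M) a (X : 'M[A]_(r, s)) j :
  lincomb e (a *: X) j = a *: lincomb e X j.
Proof. by rewrite scaler_sumr; apply: eq_bigr => i _; rewrite mxE scalerA. Qed.

Lemma lincomb0 r s (e : 'I_r -> M) j : lincomb e (0 : 'M[A]_(r, s)) j = 0.
Proof. by rewrite -(scale0r 0) lincombZ scale0r. Qed.

Lemma lincomb_delta r s (e : 'I_r -> M) i (j : 'I_s) :
  lincomb e (delta_mx i j) j = e i.
Proof.
rewrite /lincomb (bigD1 i)//= mxE !eqxx scale1r big1 ?addr0// => k ki.
by rewrite mxE (negbTE ki) scale0r.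
Qed.

Lemma lincomb1 r (e : 'I_r -> M) : lincomb e 1%:M = e.
Proof.
apply/funext => j; rewrite /lincomb (bigD1 j)//= mxE eqxx scale1r big1 ?addr0//.
by move=> i ij; rewrite mxE (negbTE ij) scale0r.
Qed.

Lemma lincomb_row r (e : 'I_r -> M) (c : 'rV[A]_r) :
  \sum_(i < r) c 0 i *: e i = lincomb e c^T 0.
Proof. by apply: eq_bigr => i _; rewrite mxE. Qed.

Lemma lincomb_col r s (e : 'I_r -> M) (X : 'M[A]_(r, s)) j :
  lincomb e (col j X) 0 = lincomb e X j.
Proof. by apply: eq_bigr => i _; rewrite mxE. Qed.

Section Basis.
Variables (r : nat) (e : 'I_r -> M).
Hypothesis e_basis : is_basis e.

Lemma lincomb_surj s (f : 'I_s -> M) : exists X, lincomb e X = f.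
Proof.
have /choice[c cE] j : exists c : 'rV[A]_r, f j = \sum_(i < r) c 0 i *: e i.
  by have [c []] := e_basis (f j); exists c.
exists (\matrix_(i, j) c j 0 i); apply/funext => j.
by rewrite cE; apply: eq_bigr => i _; rewrite mxE.
Qed.

Lemma lincomb_inj s : injective (@lincomb r s e).
Proof.
move=> X Y XY; apply/matrixP => i j.
have [c [_ c_uniq]] := e_basis (lincomb e X j).
have colE Z : lincomb e Z = lincomb e X -> c = (col j Z)^T.
  by move=> ZX; apply: c_uniq; rewrite lincomb_row trmxK lincomb_col ZX.
have /matrixP/(_ 0 i) : (col j X)^T = (col j Y)^T by rewrite -!colE.
by rewrite !mxE.
Qed.

Lemma lincomb_col_surj x : exists X : 'cV_r, x = lincomb e X 0.
Proof.
by have [X XE] := lincomb_surj (fun _ : 'I_1 => x); exists X; rewrite XE.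
Qed.

Lemma lincomb_col_inj (X Y : 'cV_r) : lincomb e X 0 = lincomb e Y 0 -> X = Y.
Proof.
by move=> XY; apply: lincomb_inj; apply/funext => j; rewrite ord1.
Qed.

Lemma lincomb_basis s (G : 'M[A]_(r, s)) (H : 'M[A]_(s, r)) :
  G *m H = 1%:M -> H *m G = 1%:M -> is_basis (lincomb e G).
Proof.
move=> GH HG x; have [C ->] := lincomb_col_surj x.
exists (H *m C)^T; split=> [|c].
  by rewrite lincomb_row trmxK lincombM mulmxA GH mul1mx.
rewrite lincomb_row lincombM => /lincomb_col_inj ->.
by apply: trmx_inj; rewrite trmxK mulmxA HG mul1mx.
Qed.

End Basis.

Lemma lincomb_transition r s (e : 'I_r -> M) (f : 'I_s -> M) :
  is_basis e -> is_basis f ->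
  exists G H, [/\ lincomb e G = f, G *m H = 1%:M & H *m G = 1%:M].
Proof.
move=> e_basis f_basis.
have [G GE] := lincomb_surj e_basis f; have [H HE] := lincomb_surj f_basis e.
exists G, H; split=> //.
  by apply: (lincomb_inj e_basis); rewrite -lincombM GE HE lincomb1.
by apply: (lincomb_inj f_basis); rewrite -lincombM HE GE lincomb1.
Qed.

End LinearCombinations.

Section Lattices.
Variables (A : comNzRingType) (M : lmodType A) (S : subringClosed A).

Definition span_over (r : nat) (e : 'I_r -> M) : set M :=
  [set x | exists2 c : 'cV[A]_r, c \is a mxOver S & x = lincomb e c 0].

Lemma mem_span_over r (e : 'I_r -> M) i : span_over e (e i).
Proof.
exists (delta_mx i 0); last by rewrite lincomb_delta.
by apply/mxOverP => k l; rewrite mxE rpred_nat.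
Qed.

Lemma span_over_submodule r (e : 'I_r -> M) :
  is_submodule [set` S] (span_over e).
Proof.
split=> [|_ _ [c cS ->] [d dS ->]|a _ aS [c cS ->]].
- by exists 0; rewrite ?rpred0// lincomb0.
- by exists (c + d); rewrite ?rpredD// lincombD.
- by exists (a *: c); rewrite ?mxOverZ// lincombZ.
Qed.

Lemma lincomb_mxOver_submodule (D : set M) r s (e : 'I_r -> M)
    (X : 'M[A]_(r, s)) j :
  is_submodule [set` S] D -> (forall i, D (e i)) -> X \is a mxOver S ->
  D (lincomb e X j).
Proof.
move=> [D0 DD DZ] De /mxOverP XS; rewrite /lincomb.
by elim/big_ind: _ => // i _; exact: DZ (XS i j) _.
Qed.

Definition is_basis_over (D : set M) (r : nat) (e : 'I_r -> M) : Prop :=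
  (forall i, D (e i)) /\ forall x, D x -> exists! c : 'rV[A]_r,
    (forall i, [set` S] (c 0 i)) /\ x = \sum_(i < r) c 0 i *: e i.

Lemma is_basis_span_over r (e : 'I_r -> M) :
  is_basis e -> is_basis_over (span_over e) e.
Proof.
move=> e_basis; split=> [i|x [c /mxOverP cS xE]]; first exact: mem_span_over.
have [d [xd d_uniq]] := e_basis x; exists d; split=> [|d' [_ /d_uniq//]].
by split=> // i; rewrite (d_uniq c^T) ?lincomb_row ?trmxK//= mxE.
Qed.

(* In the coordinates of an [S]-basis [e] of [D], the tensor product is free on
   [e], and the natural map sends a tensor to the combination of the [e i] with
   the coordinates of this tensor. *)
Section TensorCoordinates.
Variables (D : set M) (r : nat) (e : 'I_r -> M).
Hypotheses (D_submod : is_submodule [set` S] D) (e_over : is_basis_over D e).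

Local Notation tensor := (seq ({x : M | D x} * A)).
Local Notation "t1 =t t2" := (tensor_eq [set` S] t1 t2) (at level 70).

Let coordinates (x : {x : M | D x}) : 'rV[A]_r :=
  sval (cid (e_over.2 (sval x) (svalP x))).

Let coordinatesP x : (forall i, coordinates x 0 i \in S) /\
  sval x = \sum_(i < r) coordinates x 0 i *: e i.
Proof. by rewrite /coordinates; case: cid => c []. Qed.

Let coordinates_uniq x (c : 'rV[A]_r) : (forall i, c 0 i \in S) ->
  sval x = \sum_(i < r) c 0 i *: e i -> coordinates x = c.
Proof.
move=> cS xE; rewrite /coordinates; case: cid => d /= [_ d_uniq].
exact: d_uniq.
Qed.

Definition tensor_coordinates (t : tensor) : 'rV[A]_r :=
  \sum_(q <- t) q.2 *: coordinates q.1.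

Lemma tensor_mapE t :
  tensor_map t = \sum_(i < r) tensor_coordinates t 0 i *: e i.
Proof.
under eq_bigr do rewrite summxE scaler_suml.
rewrite exchange_big; apply: eq_bigr => q _.
rewrite (coordinatesP q.1).2 scaler_sumr.
by apply: eq_bigr => i _; rewrite mxE scalerA.
Qed.

Lemma eq_tensor_coordinates t1 t2 :
  t1 =t t2 -> tensor_coordinates t1 = tensor_coordinates t2.
Proof.
rewrite /tensor_coordinates; elim=> {t1 t2} //.
- by move=> t1 t2 t3 _ -> _ ->.
- by move=> t1 t2 t1' t2' _ IH1 _ IH2; rewrite !big_cat /= IH1 IH2.
- by move=> t1 t2; rewrite !big_cat /= addrC.
- by move=> x; rewrite big_seq1 big_nil scale0r.
- by move=> x a b; rewrite big_seq1 big_cons big_seq1 scalerDl.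
- move=> x y z a zE; rewrite big_seq1 big_cons big_seq1 -scalerDr /=.
  have [[xS xE] [yS yE]] := (coordinatesP x, coordinatesP y).
  congr (_ *: _); apply: coordinates_uniq => [i|]; first by rewrite mxE rpredD.
  by rewrite zE xE yE -big_split; apply: eq_bigr => i _; rewrite mxE scalerDl.
- move=> x z l a lS zE; rewrite !big_seq1 /= mulrC -scalerA.
  have [xS xE] := coordinatesP x.
  congr (_ *: _); apply: coordinates_uniq => [i|]; first by rewrite mxE rpredM.
  by rewrite zE xE scaler_sumr; apply: eq_bigr => i _; rewrite mxE scalerA.
Qed.

Definition basis_tensor (s : seq 'I_r) (c : 'rV[A]_r) : tensor :=
  [seq (exist _ (e i) (e_over.1 i), c 0 i) | i <- s].

Lemma tensor_map_basis_tensor c :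
  tensor_map (basis_tensor (index_enum 'I_r) c) = \sum_(i < r) c 0 i *: e i.
Proof. by rewrite /tensor_map big_map. Qed.

Lemma tensor_coordinates_basis_tensor c :
  tensor_coordinates (basis_tensor (index_enum 'I_r) c) = c.
Proof.
rewrite /tensor_coordinates big_map [RHS]row_sum_delta; apply: eq_bigr => i _.
congr (_ *: _); apply: coordinates_uniq => [j|]; first by rewrite mxE rpred_nat.
by rewrite lincomb_row trmx_delta lincomb_delta.
Qed.

Lemma basis_tensor0 s : basis_tensor s 0 =t [::].
Proof.
elim: s => [|i s IHs]; first exact: tensor_refl.
rewrite /basis_tensor /= mxE.
by apply: (tensor_cat (s1 := [:: _]) (s1' := [::])) IHs; exact: tensor_0.
Qed.

Lemma basis_tensorD s c d :
  basis_tensor s (c + d) =t basis_tensor s c ++ basis_tensor s d.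
Proof.
elim: s => [|i s IHs]; first exact: tensor_refl.
rewrite /basis_tensor /= mxE.
apply: tensor_trans (tensor_cat (s1 := [:: _]) (tensor_addr _ _ _ _) IHs) _.
apply: (tensor_cat (s1 := [:: _]) (s1' := [:: _])); first exact: tensor_refl.
rewrite -!/(basis_tensor _ _) -cat1s.
rewrite -[(_, d 0 i) :: basis_tensor s d]cat1s !catA.
apply: tensor_cat; last exact: tensor_refl.
exact: tensor_catC.
Qed.

Lemma pure_tensor_basis_tensor (x : {x : M | D x}) (a : A) (c : 'rV[A]_r) s :
  (forall i, c 0 i \in S) -> sval x = \sum_(i <- s) c 0 i *: e i ->
  [:: (x, a)] =t basis_tensor s (a *: c).
Proof.
have [D0 DD DZ] := D_submod; move=> cS; elim: s x => [|i s IHs] x.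
  rewrite big_nil => x0; apply: tensor_trans (tensor_0 _ x).
  have := tensor_scale (x := x) (z := x) a (rpred0 S : [set` S] 0).
  by rewrite mul0r scale0r; apply.
rewrite big_cons => xE.
have Dhead : D (c 0 i *: e i) by apply: DZ (cS i) _; exact: e_over.1.
have Dtail : D (\sum_(k <- s) c 0 k *: e k).
  by elim/big_ind: _ => // k _; apply: DZ (cS k) _; exact: e_over.1.
apply: tensor_trans (tensor_addl (x := exist _ _ Dhead) (y := exist _ _ Dtail)
  _ a xE) _.
rewrite /basis_tensor /= mxE.
apply: (tensor_cat (s1 := [:: _]) (s1' := [:: _])).
  by rewrite mulrC; apply: tensor_scale => //; exact: cS.
exact: IHs.
Qed.

Lemma tensor_eq_basis_tensor t :
  t =t basis_tensor (index_enum 'I_r) (tensor_coordinates t).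
Proof.
rewrite /tensor_coordinates; elim: t => [|[x a] t IHt].
  by rewrite big_nil; exact/tensor_sym/basis_tensor0.
rewrite big_cons; apply: tensor_trans (tensor_sym (basis_tensorD _ _ _)).
apply: (tensor_cat (s1 := [:: _])) IHt.
by have [xS xE] := coordinatesP x; exact: pure_tensor_basis_tensor.
Qed.

Lemma tensor_map_isoP : tensor_map_iso [set` S] D <-> is_basis e.
Proof.
split=> [[iso_surj iso_inj] x|e_free].
  have [t <-] := iso_surj x; exists (tensor_coordinates t).
  split=> [|c tc]; first exact: tensor_mapE.
  rewrite -[c]tensor_coordinates_basis_tensor.
  apply/eq_tensor_coordinates/iso_inj.
  by rewrite tensor_map_basis_tensor.
split=> [x|t1 t2 t12].
  have [c [xE _]] := e_free x; exists (basis_tensor (index_enum 'I_r) c).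
  by rewrite tensor_map_basis_tensor.
apply: tensor_trans (tensor_eq_basis_tensor t1) _; apply: tensor_sym.
have [c [_ c_uniq]] := e_free (tensor_map t1).
rewrite -(c_uniq _ (tensor_mapE t1)) (c_uniq (tensor_coordinates t2)).
  exact: tensor_eq_basis_tensor.
by rewrite t12 tensor_mapE.
Qed.

End TensorCoordinates.

Lemma latticeP (D : set M) :
  [/\ is_submodule [set` S] D, is_finite_free [set` S] D
    & tensor_map_iso [set` S] D]
  <-> exists (r : nat) (e : 'I_r -> M), is_basis e /\ D = span_over e.
Proof.
split=> [[D_submod [r [e e_over]] D_iso]|[r [e [e_basis ->]]]].
  exists r, e; split; first exact: (tensor_map_isoP D_submod e_over).1.
  apply/seteqP; split=> [x Dx|_ [c cS ->]].
    have [c [[cS xE] _]] := e_over.2 x Dx.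
    exists c^T; last by rewrite -lincomb_row.
    by apply/mxOverP => i j; rewrite mxE ord1; exact: cS.
  by apply: lincomb_mxOver_submodule => //; exact: e_over.1.
have e_over := is_basis_span_over e_basis.
have D_submod := span_over_submodule e.
by split=> //; [exists r, e | exact/(tensor_map_isoP D_submod e_over)].
Qed.

End Lattices.

(** * Cohomology and connection matrices *)

Section Cohomology.
Variables (M : zmodType) (phi : {additive M -> M}).
Implicit Types (D : set M) (x y : M).

Definition is_subgroup D : Prop := D 0 /\ forall x y, D x -> D y -> D (x - y).

Local Notation coset_image D y := [set y + phi x | x in D].

Lemma eq_coset_image D y1 y2 : is_subgroup D ->
  coset_image D y1 = coset_image D y2 <->
  exists2 x, D x & y1 = y2 + phi x.
Proof.
move=> [D0 DB]; split=> [eqC|[x Dx ->]].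
  have [x Dx xE] : coset_image D y2 y1.
    by rewrite -eqC; exists 0; rewrite ?raddf0 ?addr0.
  by exists x.
apply/seteqP; split=> _ [z Dz <-].
  exists (x - (0 - z)); first exact: DB Dx (DB _ _ D0 Dz).
  by rewrite sub0r opprK raddfD addrA.
by exists (z - x); [exact: DB | rewrite raddfB -addrA subrKC].
Qed.

Lemma H1_map_coset_image D y : is_subgroup D ->
  H1_map phi (coset_image D y) = coset_image setT y.
Proof.
move=> [D0 _]; apply/seteqP; split=> [_ [_ [x _ <-] [z _ <-]]|_ [x _ <-]].
  by exists (x + z) => //; rewrite raddfD addrA.
by exists y; [exists 0; rewrite ?raddf0 ?addr0 | exists x].
Qed.

Lemma RGamma_quasi_isoI D : is_subgroup D ->
  (forall x, D (phi x) -> D x) ->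
  (forall y, exists2 d, D d & exists x, y = d + phi x) ->
  RGamma_quasi_iso phi D.
Proof.
move=> subD phi_preim phi_coker; have subT : is_subgroup [set: M] by split.
have [D0 DB] := subD; split; split=> //.
- by move=> x [].
- move=> x [_ phix0]; exists x => //; split=> //.
  by apply: phi_preim; rewrite phix0.
- by move=> _ [y Dy <-]; exists y; rewrite ?H1_map_coset_image.
- move=> _ _ /set_mem[y1 Dy1 <-] /set_mem[y2 Dy2 <-].
  rewrite !H1_map_coset_image//.
  move=> /(eq_coset_image _ _ subT)[x _ y1E]; apply/eq_coset_image => //.
  exists x => //; apply: phi_preim.
  by rewrite -[phi x](addKr y2) -y1E addrC; exact: DB.
- move=> _ [y _ <-]; have [d Dd [x yE]] := phi_coker y.
  exists (coset_image D d); first by exists d.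
  rewrite H1_map_coset_image//; apply/esym/(eq_coset_image _ _ subT).
  by exists x.
Qed.

End Cohomology.

Lemma submodule_subgroup (A : comNzRingType) (M : lmodType A)
    (S : subringClosed A) (D : set M) :
  is_submodule [set` S] D -> is_subgroup D.
Proof.
move=> [D0 DD DZ]; split=> // x y Dx Dy; rewrite -scaleN1r.
by apply: DD => //; apply: DZ => //=; rewrite rpredN1.
Qed.

Section Connection.
Variables (F : fieldType) (M : lmodType (powser F)) (phi : M -> M).
Hypothesis phi_conn : is_connection phi.

Fact connection_zmod_morphism : zmod_morphism phi.
Proof.
move=> x y; rewrite -scaleN1r addrC -[phi x - _]addrC -[in RHS]scaleN1r.
have NE : -1 = ps_const (-1) :> powser F.
  by apply/powserP => -[|k] /=; rewrite ?mulr1n ?mulr0n ?oppr0.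
by rewrite NE phi_conn.1.
Qed.

Definition connection_additive : {additive M -> M} :=
  HB.pack phi (GRing.isZmodMorphism.Build M M phi connection_zmod_morphism).

Definition is_connection_matrix (r : nat) (e : 'I_r -> M)
    (P : 'M[powser F]_r) : Prop :=
  phi \o e = lincomb e P.

Lemma connection_lincomb (r s : nat) (e : 'I_r -> M) P
    (X : 'M[powser F]_(r, s)) :
  is_connection_matrix e P ->
  phi \o lincomb e X = lincomb e (map_mx (@theta F) X + P *m X).
Proof.
move=> eP; apply/funext => j; rewrite lincombD -lincombM -eP /=.
rewrite [LHS](raddf_sum connection_additive) -big_split; apply: eq_bigr => i _.
by rewrite mxE /= phi_conn.2.
Qed.

Lemma ex_connection_matrix r (e : 'I_r -> M) :
  is_basis e -> exists P, is_connection_matrix e P.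
Proof. by move=> /lincomb_surj/(_ r (phi \o e))[P eP]; exists P. Qed.

Lemma hom_connection_transition r s (e : 'I_r -> M) (f : 'I_s -> M) P Q G :
  is_basis e -> is_connection_matrix e P -> is_connection_matrix f Q ->
  lincomb e G = f -> hom_connection P Q G = 0.
Proof.
move=> e_basis eP fQ eG; apply/eqP; rewrite subr_eq0; apply/eqP.
apply: (lincomb_inj e_basis); rewrite -(connection_lincomb _ eP) -lincombM eG.
exact: fQ.
Qed.

Lemma residue_matrix_coefmx0 r (e : 'I_r -> M) P N :
  is_basis e -> is_connection_matrix e P -> residue_matrix phi e N ->
  coefmx 0 P = N.
Proof.
move=> e_basis eP /choice[y yE]; have [Y eY] := lincomb_surj e_basis y.
have -> : P = map_mx (@ps_const F) N + psX F *: Y.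
  apply: (lincomb_inj e_basis); rewrite -eP; apply/funext => j.
  rewrite lincombD lincombZ eY /= yE; congr (_ + _).
  by apply: eq_bigr => i _; rewrite mxE.
apply/matrixP => i j; rewrite !mxE /= /coefps /= big_ord1 /= mul0r addr0.
exact: mulr1n.
Qed.

Lemma coefmx0_similar r s (P : 'M[powser F]_r) (Q : 'M[powser F]_s) G H :
  G *m H = 1%:M -> H *m G = 1%:M -> hom_connection P Q G = 0 ->
  char_poly (coefmx 0 P) = char_poly (coefmx 0 Q).
Proof.
move=> GH HG connG0.
have coef0M a b c (X : 'M[powser F]_(a, b)) (Y : 'M[powser F]_(b, c)) :
    coefmx 0 X *m coefmx 0 Y = coefmx 0 (X *m Y) by rewrite coefmxM big_ord1.
apply: (@char_poly_similar _ _ _ _ _ (coefmx 0 G) (coefmx 0 H)).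
- by rewrite coef0M GH coefmx1.
- by rewrite coef0M HG coefmx1.
have := congr1 (@coefmx F 0 r s) connG0.
rewrite coefmx_hom_connection /hom_connection_tail big_ord0 addr0 raddf0.
rewrite /indicial /sylvester raddf0 add0r.
by move/eqP; rewrite subr_eq0 => /eqP.
Qed.

Lemma char_poly_has_exponents (E : fieldType) (inj : {rmorphism F -> E}) r s
    (lambda : 'I_r -> E) (e : 'I_s -> M) P :
  has_exponents inj phi lambda -> is_basis e -> is_connection_matrix e P ->
  char_poly (map_mx inj (coefmx 0 P)) = \prod_i ('X - (lambda i)%:P).
Proof.
move=> [f [N [f_basis fN charN]]] e_basis eP.
have [Q fQ] := ex_connection_matrix f_basis.
have [G [H [eG GH HG]]] := lincomb_transition e_basis f_basis.
have connG0 := hom_connection_transition e_basis eP fQ eG.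
rewrite -charN -(residue_matrix_coefmx0 f_basis fQ fN) -!map_char_poly.
by rewrite (coefmx0_similar GH HG connG0).
Qed.

Section StableLattice.
Variable S : subringClosed (powser F).
Hypothesis S_theta : forall f, f \in S -> theta f \in S.

Lemma stable_latticeP (D : set M) : is_stable_lattice [set` S] phi D <->
  exists (r : nat) (e : 'I_r -> M) P, [/\ is_basis e, D = span_over S e,
    is_connection_matrix e P & P \is a mxOver S].
Proof.
split=> [[D_submod D_free D_iso D_phi]|[r [e [P [e_basis -> eP PS]]]]].
  have [r [e [e_basis DE]]] := (latticeP S D).1 (And3 D_submod D_free D_iso).
  have [P eP] := ex_connection_matrix e_basis; exists r, e, P; split=> //.
  apply/mxOverP => i j; have : D (phi (e j)).
    by apply: D_phi; rewrite DE; exact: mem_span_over.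
  rewrite DE => -[c /mxOverP cS phi_eE].
  suff -> : P i j = c i 0 by [].
  have /matrixP/(_ i 0) : col j P = c; last by rewrite mxE.
  by apply: (lincomb_col_inj e_basis); rewrite -phi_eE lincomb_col -eP.
have [submod free iso] := (latticeP S (span_over S e)).2 (ex_intro _ r
  (ex_intro _ e (conj e_basis erefl))).
split=> // _ [c cS ->]; exists (map_mx (@theta F) c + P *m c).
  rewrite rpredD ?mxOverM//.
  by apply/mxOverP => i j; rewrite mxE; exact/S_theta/mxOverP.
by rewrite -(connection_lincomb _ eP).
Qed.

End StableLattice.
End Connection.

(** * Overconvergent lattices *)

Section OverconvergentLattices.
Variables (R : realType) (p : nat) (K : fieldType) (Kbar : closedFieldType).
Variables (iota : {rmorphism K -> Kbar}) (v : valuation R Kbar).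
Hypotheses (p_prime : prime p) (vp1 : v p%:R = 1%E).

Local Notation F := (Kinf p iota).
Local Notation inj := (@Kinf_val p K Kbar iota).
Local Notation L := (overconvergent iota v).

Variables (M : lmodType (powser F)) (phi : M -> M).
Hypothesis phi_conn : is_connection phi.
Variables (r : nat) (lambda : 'I_r -> Kbar).
Hypothesis phi_exp : has_exponents inj phi lambda.

(* Past the last resonance [k0] every equation is solvable, so the terms of [P]
   of order above [k0] can be gauged away. *)
Lemma gauge_truncmx s (e : 'I_s -> M) P :
  is_basis e -> is_connection_matrix phi e P ->
  exists k0 G H, [/\ G *m H = 1%:M, H *m G = 1%:M
                   & hom_connection P (truncmx k0 P) G = 0].
Proof.
move=> e_basis eP.
have charP := char_poly_has_exponents phi_conn phi_exp e_basis eP.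
have [k0 _ inj_k0] := near_indicial_inj_Kinf p_prime vp1 charP charP.
pose Q := truncmx k0 P.
have PQ0 : coefmx 0 Q = coefmx 0 P by rewrite coefmx_truncmx.
have [k kk0|k kk0|X connX X0] := @hom_connection_surj _ _ _ P Q (Q - P) k0.
- by rewrite /indicial PQ0; exact: inj_k0 (ltnW kk0).
- by rewrite -opprB raddfN /= coefmx_subr_truncmx ?oppr0.
have G0 : coefmx 0 (1%:M + X) = 1%:M by rewrite raddfD /= coefmx1 X0// addr0.
have [H [GH HG]] := powser_mx_invertible G0.
exists k0, (1%:M + X), H; split=> //.
by rewrite raddfD /= connX hom_connection1 addrA subrK subrr.
Qed.

Lemma exists_stable_lattice : exists D, is_stable_lattice [set` L] phi D.
Proof.
have [e [_ [e_basis _ _]]] := phi_exp.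
have [P eP] := ex_connection_matrix phi e_basis.
have [k0 [G [H [GH HG connG]]]] := gauge_truncmx e_basis eP.
exists (span_over L (lincomb e G)).
apply/(stable_latticeP phi_conn (@overconvergent_theta _ _ _ _ _ _)).
exists r, (lincomb e G), (truncmx k0 P); split=> //.
- exact: lincomb_basis GH HG.
- rewrite /is_connection_matrix (connection_lincomb phi_conn _ eP) lincombM.
  by congr lincomb; apply/eqP; rewrite -subr_eq0; exact/eqP.
- exact: truncmx_overconvergent.
Qed.

Lemma stable_lattice_char_poly D : is_stable_lattice [set` L] phi D ->
  exists s (e : 'I_s -> M) P, [/\ is_basis e, D = span_over L e,
    is_connection_matrix phi e P, P \is a mxOver L &
    char_poly (map_mx inj (coefmx 0 P)) = \prod_i ('X - (lambda i)%:P)].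
Proof.
move=> /(stable_latticeP phi_conn (@overconvergent_theta _ _ _ _ _ _)).
move=> [s [e [P [e_basis DE eP PL]]]]; exists s, e, P; split=> //.
exact: char_poly_has_exponents phi_exp e_basis eP.
Qed.

Section Span.
Variables (s : nat) (e : 'I_s -> M) (P : 'M[powser F]_s).
Hypotheses (e_basis : is_basis e) (eP : is_connection_matrix phi e P).
Hypothesis char_P :
  char_poly (map_mx inj (coefmx 0 P)) = \prod_i ('X - (lambda i)%:P).

Let char_0 : char_poly (map_mx inj (coefmx 0 (0 : 'M[powser F]_1))) =
  \prod_(j < 1) ('X - 0%:P).
Proof. by rewrite big_ord1 /char_poly det_mx11 !mxE. Qed.

Lemma phi_lincomb_col (X : 'cV_s) :
  phi (lincomb e X 0) = lincomb e (hom_connection P 0 X) 0.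
Proof.
by rewrite /hom_connection mulmx0 subr0 -(connection_lincomb phi_conn _ eP).
Qed.

Lemma span_over_phi_preim x :
  (forall i, (0 < padic_type p v (- lambda i)%R)%E) -> P \is a mxOver L ->
  span_over L e (phi x) -> span_over L e x.
Proof.
move=> types_gt0 PL; have [X ->] := lincomb_col_surj e_basis x.
rewrite phi_lincomb_col => -[c cL /(lincomb_col_inj e_basis) connX].
exists X; last by [].
apply: (hom_connection_overconvergent p_prime vp1 char_P char_0 _ PL).
- by move=> i _; rewrite sub0r.
- exact: rpred0.
- by rewrite connX.
Qed.

Lemma span_over_phi_coker y :
  exists2 d, span_over L e d & exists x, y = d + phi x.
Proof.
have [Y ->] := lincomb_col_surj e_basis y.
have [k0 _ inj_k0] := near_indicial_inj_Kinf p_prime vp1 char_P char_0.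
have [||X connX _] := hom_connection_surj (P := P) (Q := 0)
  (Y := Y - truncmx k0 Y) (k0 := k0).
- by move=> k /ltnW; exact: inj_k0.
- by move=> k; exact: coefmx_subr_truncmx.
exists (lincomb e (truncmx k0 Y) 0).
  by exists (truncmx k0 Y); first exact: truncmx_overconvergent.
by exists (lincomb e X 0); rewrite phi_lincomb_col connX -lincombD addrC subrK.
Qed.

End Span.

Lemma stable_lattice_quasi_iso D :
  (forall i, (0 < padic_type p v (- lambda i)%R)%E) ->
  is_stable_lattice [set` L] phi D -> RGamma_quasi_iso phi D.
Proof.
move=> types_gt0 /stable_lattice_char_poly[s [e [P [e_basis -> eP PL charP]]]].
apply: (RGamma_quasi_isoI (phi := connection_additive phi_conn)).
- exact: submodule_subgroup (span_over_submodule L e).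
- by move=> x; exact: span_over_phi_preim eP charP x types_gt0 PL.
- exact: span_over_phi_coker eP charP.
Qed.

Lemma stable_lattice_sub D D' :
  (forall i j, (0 < padic_type p v (lambda i - lambda j)%R)%E) ->
  is_stable_lattice [set` L] phi D -> is_stable_lattice [set` L] phi D' ->
  D' `<=` D.
Proof.
move=> types_gt0 /stable_lattice_char_poly[s [e [P [e_basis -> eP PL charP]]]].
move=> /stable_lattice_char_poly[s' [f [Q [f_basis -> fQ QL charQ]]]].
have [G GE] := lincomb_surj e_basis f.
have GL : G \is a mxOver L.
  apply: (hom_connection_overconvergent p_prime vp1 charP charQ _ PL QL).
    by move=> i j; exact: types_gt0.
  by rewrite (hom_connection_transition phi_conn e_basis eP fQ GE) rpred0.
by move=> _ [c cL ->]; exists (G *m c); rewrite ?mxOverM// -lincombM GE.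
Qed.

End OverconvergentLattices.

Theorem theorem11p4 (R : realType) (p : nat)
  (K : fieldType) (v : K -> \bar R)
  (hK0 : [pchar K] =i pred0)
  (hv : is_valuation v) (hdisc : is_discrete v) (hcomp : is_complete v)
  (hchar : residue_char v p) (hperf : residue_perfect v p)
  (Kbar : closedFieldType) (iota : {rmorphism K -> Kbar})
  (halg : forall x : Kbar, algebraicOver iota x)
  (vp : Kbar -> \bar R) (hvp : is_valuation vp) (hvpp : vp p%:R = 1%E)
  (hext : forall x : K, v x = (v p%:R * vp (iota x))%E)
  (M : lmodType (powser (Kinf p iota))) (phi : M -> M)
  (r : nat) (hphi : is_regular_connection r phi)
  (lambda : 'I_r -> Kbar) (hlambda : has_exponents (@Kinf_val p K Kbar iota) phi lambda) :
  [/\ exists D : set M, is_stable_lattice (Ldag vp) phi D,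
      (forall i, (0 < padic_type p vp (- lambda i)%R)%E) ->
        forall D : set M, is_stable_lattice (Ldag vp) phi D ->
          RGamma_quasi_iso phi D
    & (forall i j, (0 < padic_type p vp (lambda i - lambda j)%R)%E) ->
        exists! D : set M, is_stable_lattice (Ldag vp) phi D].
Proof.
have [p_prime _] := hchar; have [_ phi_conn] := hphi.
have [w vpE] : exists w : valuation R Kbar, vp = w by exists (Valuation hvp).
rewrite vpE in hvpp *; rewrite LdagE//.
have [D D_lattice] := exists_stable_lattice p_prime hvpp phi_conn hlambda.
split=> [|types_gt0 D'|types_gt0]; first by exists D.
  exact: (stable_lattice_quasi_iso p_prime hvpp phi_conn hlambda).
have sub := stable_lattice_sub p_prime hvpp phi_conn hlambda types_gt0.
by exists D; split=> // D' D'_lattice; apply/seteqP; split; exact: sub.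
Qed.
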